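(* Let $k$ be a positive integer and let $K = \{1,2,\dotsc,k\} \subset \mathbb{Z}_+$. Let $z_1,z_2,\dotsc,z_n$ be distinct points in $\mathbb{D}$ and let $w_1,w_2,\dotsc,w_n$ be points in $\mathbb{D}$. There exists an analytic function $f \in H^{\infty}_K(\mathbb{D})$ with $f(z_i)=w_i$ for $i = 1, 2, \dotsc,n$ and $\|f\|_{\infty} \leq 1$ if and only if there exists a $\lambda \in \mathbb{D}$ such that the $n\times n$ matrix $$\left[\frac{z_i^{k+1}\, \overline{z_j^{k+1}} - \varphi_{\lambda}(w_i)\, \overline{\varphi_{\lambda}(w_j)}}{1-z_i\overline{z_j}}\right]_{i,j=1}^n$$ is positive semidefinite.
   Context: $\mathbb{D}$ is the open unit disk in $\mathbb{C}$ and $\mathbb{Z}_+$ is the set of positive integers. $H^{\infty}(\mathbb{D})$ is the set of bounded analytic functions on $\mathbb{D}$, with $\|f\|_\infty = \sup\{|f(z)| : z\in\mathbb{D}\}$. For a nonempty set $K\subset\mathbb{Z}_+$, $H^{\infty}_K(\mathbb{D}) = \{f\in H^{\infty}(\mathbb{D}) : f^{(k)}(0)=0 \text{ for all } k\in K\}$. For $\lambda\in\mathbb{D}$, $\varphi_{\lambda}(z) = \frac{z-\lambda}{1-\overline{\lambda}z}$. *)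

(* Defs.v *)
From HB Require Import structures.
From mathcomp Require Import all_boot all_order all_algebra complex.
From mathcomp Require Import all_classical all_reals all_analysis.

Set Implicit Arguments.
Unset Strict Implicit.
Unset Printing Implicit Defensive.

Import Order.TTheory GRing.Theory Num.Theory.
Import numFieldNormedType.Exports.

Local Open Scope classical_set_scope.
Local Open Scope ring_scope.

(* Declared at [numFieldType] because it is from that structure that a field
   inherits its topology and its normed-module structure over itself. *)
Definition Cplx (R : realType) : numFieldType := R[i].

Section Disk.
Variable R : realType.
Local Notation C := (Cplx R).

(* In [C] the norm [`|z|] is a complex number with zero imaginary part. *)
Definition cmod (z : C) : R := complex.Re `|z|.

Definition disk : set C := [set z | `|z| < 1].

(* Local representability by convergent power series. *)
Definition analytic_on (U : set C) (f : C -> C) : Prop :=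
  forall c, U c -> exists a : nat -> C,
    \forall z \near c, [series a m * (z - c) ^+ m]_m @ \oo --> f z.

(* Functions on the disk are total functions on [C]; their values outside the
   disk are irrelevant. *)
Definition Hinf : set (C -> C) :=
  [set f | analytic_on disk f /\
           exists M : R, forall z, disk z -> cmod (f z) <= M].

Definition Hinf_norm (f : C -> C) : R := sup [set cmod (f z) | z in disk].

Definition Hinf_vanish (K : set nat) : set (C -> C) :=
  [set f | Hinf f /\ forall j, K j -> (f^`(j))%classic 0 = 0].

Definition phi (lambda z : C) : C := (z - lambda) / (1 - lambda^* * z).

(* [0 <= x] in [C] says that [x] is real and nonnegative, so a matrix
   satisfying this is Hermitian. *)
Definition psdmx (n : nat) (A : 'M[C]_n) : Prop :=
  forall x : 'cV[C]_n, 0 <= \sum_i \sum_j (x i 0)^* * A i j * x j 0.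

End Disk.

(* Main.v *)
(* The proof is the Schur-Nevanlinna algorithm.  For a point [z0] with
   [|w0| < 1], Schur-complementing the [z0] row out of the Pick matrix gives, up
   to a diagonal congruence, the Pick matrix at the remaining points of
   [(w - w0) / (1 - w0^* w) / ((z - z0) / (1 - z0^* z))].  Read backwards this
   constructs a rational interpolant from a positive semidefinite matrix; read
   forwards, the reduction step maps analytic functions bounded by 1 to such
   functions by the maximum principle, which gives necessity.

   The theorem follows by applying this to [h], where [phi_lambda o f =
   z^(k+1) h] and [lambda = f 0]: the derivatives of [f] of orders [1, ..., k]
   vanish at 0 exactly when [f - f 0] is [O(z^(k+1))].

   Analytic functions enter the complex analysis only through the fact that they
   have Taylor expansions with remainder [O(t^n)] for every [n] at every point of
   the disk; this class is visibly stable under products, inverses and division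
   by a zero, and expansions of order 3 suffice for the maximum principle. *)
Require Import Defs.
From mathcomp Require Import all_boot all_order all_algebra complex.
From mathcomp Require Import ring lra zify.

Set Implicit Arguments.
Unset Strict Implicit.
Unset Printing Implicit Defensive.

Import Order.TTheory GRing.Theory Num.Theory.

Local Open Scope ring_scope.

(** * Positive semidefinite kernels and Pick interpolation *)

Section Kernels.
Variables (C : numClosedFieldType) (I : finType).
Implicit Types (A B : {set I}) (K L : I -> I -> C) (x : I -> C).

(** The index set is a subset of a fixed finite type, so that the Schur reduction can delete a point
    without reindexing. *)
Definition qform A K x : C :=
  \sum_(i in A) \sum_(j in A) (x i)^* * K i j * x j.

Definition psd_on A K := forall x, 0 <= qform A K x.

Lemma eq_psd_on A K L :
  {in A &, forall i j, K i j = L i j} -> psd_on A K -> psd_on A L.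
Proof.
move=> KL Kp x; rewrite -[qform _ _ _](_ : qform A K x = _) //.
by apply: eq_bigr => i Ai; apply: eq_bigr => j Aj; rewrite KL.
Qed.

Lemma psd_on_sub A B K : B \subset A -> psd_on A K -> psd_on B K.
Proof.
move=> BA Kp x; have := Kp (fun i => if i \in B then x i else 0).
congr (0 <= _); rewrite /qform (big_setID B) /= (setIidPr BA).
rewrite [X in _ + X]big1 ?addr0; last first.
  move=> i /setDP[_ /negbTE ->]; apply: big1 => j _.
  by rewrite conjC0 !mul0r.
apply: eq_bigr => i ->; rewrite (big_setID B) /= (setIidPr BA).
rewrite [X in _ + X]big1 ?addr0; last first.
  by move=> j /setDP[_ /negbTE ->]; rewrite mulr0.
by apply: eq_bigr => j ->.
Qed.

Lemma psd_on_congr A K (d : I -> C) :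
  psd_on A K -> psd_on A (fun i j => d i * (d j)^* * K i j).
Proof.
move=> Kp x; have := Kp (fun i => (d i)^* * x i).
congr (0 <= _); apply: eq_bigr => i _; apply: eq_bigr => j _.
by rewrite rmorphM /= conjCK; ring.
Qed.

Lemma psd_on_scale A K (c : C) :
  0 <= c -> psd_on A K -> psd_on A (fun i j => c * K i j).
Proof.
move=> c0 Kp x; have -> : qform A (fun i j => c * K i j) x = c * qform A K x.
  rewrite /qform mulr_sumr; apply: eq_bigr => i _.
  by rewrite mulr_sumr; apply: eq_bigr => j _; ring.
exact: mulr_ge0.
Qed.

Lemma psd_on_diag A K i : psd_on A K -> i \in A -> 0 <= K i i.
Proof.
move=> Kp iA; have iA' : [set i] \subset A by rewrite sub1set.
have := psd_on_sub iA' Kp (fun=> 1).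
by rewrite /qform !big_set1 conjC1 mul1r mulr1.
Qed.

(** If [K i i = 0], the form on the span of the coordinates [i] and [j] has a cross term with no
    square to control it, so a nonzero cross term could make the form negative. *)
Lemma psd_on_diag0 A K i j : psd_on A K -> {in A &, forall i j, K j i = (K i j)^*} ->
  i \in A -> j \in A -> K i i = 0 -> K i j = 0.
Proof.
move=> Kp Kh iA jA Ki0; have [<- //|neq_ij] := eqVneq i j.
apply/eqP; apply: contraT => Kij0.
have sA : i |: [set j] \subset A by rewrite subUset !sub1set iA jA.
have KjjC : (K j j)^* = K j j by rewrite -Kh.
have Kjj0 := psd_on_diag Kp jA.
have N0 : K i j * (K i j)^* != 0 by rewrite mulf_neq0 ?conjC_eq0.
(* With [x i = - t * K i j] and [x j = 1] the form is [K j j - 2 * t * |K i j|^2]; this [t] makes it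
   [- (K j j + 2)], which is negative. *)
pose t := (K j j + 1) / (K i j * (K i j)^*).
have tC : t^* = t.
  by rewrite /t rmorphM fmorphV rmorphD !rmorphM rmorph1 /= conjCK KjjC (mulrC (K i j)).
have := psd_on_sub sA Kp (fun k => if k == j then 1 else - t * K i j).
rewrite /qform big_setU1 ?inE // !big_set1 !big_setU1 ?inE //= !big_set1.
rewrite eqxx (negbTE neq_ij) Ki0 (Kh i j) // conjC1 rmorphM rmorphN /= tC.
rewrite [X in 0 <= X](_ : _ = - (K j j + 2)); last first.
  have tN : t * (K i j * (K i j)^*) = K j j + 1 by rewrite divfK.
  transitivity (K j j - 2 * (t * (K i j * (K i j)^*))); first by ring.
  by rewrite tN; ring.
by rewrite oppr_ge0 lt_geF // ltr_wpDl.
Qed.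

(** Completing the square in the coordinate [x i0]; the remainder is the form of the Schur
    complement. *)
Lemma qform_schur A K i0 x : i0 \in A -> K i0 i0 != 0 ->
  {in A, forall j, K j i0 = (K i0 j)^*} ->
  let y := \sum_(j in A) K i0 j * x j in
  qform A K x =
    qform (A :\ i0) (fun i j => K i j - K i i0 * K i0 j / K i0 i0) x
    + y * y^* / K i0 i0.
Proof.
move=> Ai0 K0 Kh y; rewrite /qform.
pose s := \sum_(j in A :\ i0) K i0 j * x j.
have yE : y = K i0 i0 * x i0 + s by rewrite /y (big_setD1 i0).
have sE : s^* = \sum_(j in A :\ i0) (x j)^* * K j i0.
  rewrite /s rmorph_sum; apply: eq_bigr => j /setD1P[_ Aj] /=.
  by rewrite rmorphM /= -Kh // mulrC.
have K0c : (K i0 i0)^* = K i0 i0 by rewrite -Kh.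
have -> : \sum_(i in A :\ i0) \sum_(j in A :\ i0)
      (x i)^* * (K i j - K i i0 * K i0 j / K i0 i0) * x j
    = \sum_(i in A :\ i0) \sum_(j in A :\ i0) (x i)^* * K i j * x j
      - s^* * s / K i0 i0.
  rewrite sE -mulrA mulr_suml -sumrB; apply: eq_bigr => i _.
  rewrite /s [_ / K i0 i0]mulr_suml mulr_sumr -sumrB.
  by apply: eq_bigr => j _; field.
rewrite (big_setD1 i0) //= (big_setD1 i0) //=.
have -> : \sum_(j in A :\ i0) (x i0)^* * K i0 j * x j = (x i0)^* * s.
  by rewrite mulr_sumr; apply: eq_bigr => j _; rewrite mulrA.
have -> : \sum_(i in A :\ i0) \sum_(j in A) (x i)^* * K i j * x j
    = s^* * x i0 + \sum_(i in A :\ i0) \sum_(j in A :\ i0) (x i)^* * K i j * x j.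
  rewrite sE mulr_suml -big_split /=; apply: eq_bigr => i _.
  by rewrite (big_setD1 i0).
by rewrite yE rmorphD rmorphM /= K0c; field.
Qed.

Lemma psd_on_schur A K i0 : i0 \in A -> 0 < K i0 i0 ->
  {in A, forall j, K j i0 = (K i0 j)^*} ->
  psd_on A K <-> psd_on (A :\ i0) (fun i j => K i j - K i i0 * K i0 j / K i0 i0).
Proof.
move=> Ai0 Kgt Kh; have K0 : K i0 i0 != 0 by rewrite gt_eqF.
split=> Kp x; last first.
  rewrite (qform_schur x Ai0 K0 Kh) addr_ge0 //.
  by rewrite divr_ge0 ?mul_conjC_ge0 // ltW.
pose s := \sum_(j in A :\ i0) K i0 j * x j.
(* This value at [i0] annihilates the completed square, leaving only the Schur complement. *)
pose x' i := if i == i0 then - s / K i0 i0 else x i.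
have x'E i : i \in A :\ i0 -> x' i = x i.
  by rewrite /x' => /setD1P[/negbTE -> _].
have := Kp x'; rewrite (qform_schur x' Ai0 K0 Kh) (big_setD1 i0) //=.
have -> : \sum_(j in A :\ i0) K i0 j * x' j = s.
  by apply: eq_bigr => j /x'E ->.
have -> : x' i0 = - s / K i0 i0 by rewrite /x' eqxx.
rewrite mulrCA mulfV // mulr1 addNr !mul0r addr0.
congr (0 <= _); apply: eq_bigr => i /x'E ->.
by apply: eq_bigr => j /x'E ->.
Qed.

End Kernels.

(** * Moebius maps of the unit disk *)

Section Disk.
Variable C : numClosedFieldType.
Implicit Types x y a : C.

Lemma one_subM_neq0 x y : `|x| < 1 -> `|y| <= 1 -> 1 - x * y != 0.
Proof.
move=> x1 y1; rewrite subr_eq0; apply/eqP => xy.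
have : `|x * y| < 1 by rewrite normrM (le_lt_trans _ x1) // ler_piMr.
by rewrite -xy normr1 ltxx.
Qed.

Lemma norm_conjC_lt1 x : `|x| < 1 -> `|x^*| < 1.
Proof. by rewrite norm_conjC. Qed.

Lemma norm_conjC_le1 x : `|x| <= 1 -> `|x^*| <= 1.
Proof. by rewrite norm_conjC. Qed.

Lemma conjC_one_subM x y : (1 - x * y^*)^* = 1 - y * x^*.
Proof. by rewrite rmorphB rmorph1 rmorphM /= conjCK mulrC. Qed.

Lemma conjC_sub x y : (x - y)^* = x^* - y^*.
Proof. exact: rmorphB. Qed.

Lemma one_sub_normsq_gt0 x : `|x| < 1 -> 0 < 1 - x * x^*.
Proof. by move=> x1; rewrite -normCK subr_gt0 expr_lt1. Qed.

(** Homogeneous form of the fact that a disk automorphism preserves the closed disk, with [y / x] as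
    the point. It rests on [|x + b^* y|^2 - |y + b x|^2 = (1 - |b|^2) (|x|^2 - |y|^2)]. *)
Lemma mobius_le x y b : x != 0 -> `|y| <= `|x| -> `|b| < 1 ->
  x + b^* * y != 0 /\ `|y + b * x| <= `|x + b^* * y|.
Proof.
move=> x0 yx b1; split.
  apply/eqP => /(canRL (addrK _)); rewrite sub0r => xE.
  have : `|x| <= `|b| * `|x|.
    by rewrite [X in X <= _](congr1 Num.norm xE) normrN normrM norm_conjC ler_wpM2l.
  by rewrite lt_geF // gtr_pMl ?normr_gt0.
rewrite -(ler_pXn2r (n := 2)) ?nnegrE // -subr_ge0 !normCK.
have -> : (x + b^* * y) * (x + b^* * y)^* - (y + b * x) * (y + b * x)^* =
    (1 - b * b^*) * (x * x^* - y * y^*).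
  by rewrite !rmorphD !rmorphM /= !conjCK; ring.
apply: mulr_ge0; first by rewrite ltW ?one_sub_normsq_gt0.
by rewrite -!normCK subr_ge0 lerXn2r ?nnegrE.
Qed.

Lemma blaschke_le1 x a : `|x| <= 1 -> `|a| < 1 -> `|x - a| <= `|1 - a^* * x|.
Proof.
move=> x1 a1; have [|||_] := @mobius_le 1 x (- a); rewrite ?normrN ?normr1 ?oner_eq0 //.
by rewrite rmorphN /= mulr1 mulNr.
Qed.

(* [w' = ((w - w0) / (1 - w0^* w)) / ((z - z0) / (1 - z0^* z))], without
   divisions so that it also makes sense at [z = z0]. *)
Definition schur_step (z w z0 w0 w' : C) :=
  (z - z0) * (1 - w0^* * w) * w' = (w - w0) * (1 - z0^* * z).

End Disk.

(** * Schur reduction of the Pick kernel and rational interpolants *)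

Section Pick.
Variables (C : numClosedFieldType) (I : finType).
Implicit Types (A : {set I}) (z w : I -> C).

Definition pick_kernel z w (i j : I) : C :=
  (1 - w i * (w j)^*) / (1 - z i * (z j)^*).

Lemma pick_kernelC z w i j : pick_kernel z w j i = (pick_kernel z w i j)^*.
Proof. by rewrite /pick_kernel rmorphM /= fmorphV /= !conjC_one_subM. Qed.

(** The factor [d] is chosen so that [d i * w' i = w i - w i0]. Substituting this removes [w'], and
    what remains is an identity of rational functions in [z], [w] and their conjugates. *)
Lemma pick_kernel_schur z w w' i0 i j :
  (forall i, `|z i| < 1) -> `|w i0| < 1 -> `|w i| <= 1 -> `|w j| <= 1 ->
  schur_step (z i) (w i) (z i0) (w i0) (w' i) ->
  schur_step (z j) (w j) (z i0) (w i0) (w' j) ->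
  let K := pick_kernel z w in
  let d k := (1 - (w i0)^* * w k) * (z k - z i0) / (1 - (z i0)^* * z k) in
  K i j - K i i0 * K i0 j / K i0 i0 =
  (1 - w i0 * (w i0)^*)^-1 * (d i * (d j)^* * pick_kernel z w' i j).
Proof.
move=> z1 w01 wi1 wj1 Hi Hj K d.
have n1 : 1 - z i * (z j)^* != 0 by rewrite one_subM_neq0 ?norm_conjC_le1 ?ltW.
have n2 : 1 - z i * (z i0)^* != 0 by rewrite one_subM_neq0 ?norm_conjC_le1 ?ltW.
have n3 : 1 - z i0 * (z j)^* != 0 by rewrite one_subM_neq0 ?norm_conjC_le1 ?ltW.
have n4 : 1 - z i0 * (z i0)^* != 0 by rewrite one_subM_neq0 ?norm_conjC_le1 ?ltW.
have n5 : 1 - w i0 * (w i0)^* != 0.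
  by rewrite one_subM_neq0 ?norm_conjC_le1 ?ltW.
have n6 : 1 - (z i0)^* * z i != 0 by rewrite mulrC.
have dwi : d i * w' i = w i - w i0.
  by rewrite /d mulrAC [X in X * w' i]mulrC Hi mulfK.
have dwj : (d j)^* * (w' j)^* = (w j)^* - (w i0)^*.
  rewrite -rmorphM /= -conjC_sub; congr (_^*).
  rewrite /d mulrAC [X in X * w' j]mulrC Hj mulfK //.
  by rewrite mulrC one_subM_neq0 ?norm_conjC_le1 ?ltW.
have djE : (d j)^* = (1 - w i0 * (w j)^*) * ((z j)^* - (z i0)^*)
                     / (1 - z i0 * (z j)^*).
  rewrite /d rmorphM rmorphM /= fmorphV /= conjC_sub ![_^* * _ j]mulrC.
  by rewrite !conjC_one_subM.
have -> : d i * (d j)^* * pick_kernel z w' i j =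
    (d i * (d j)^* - (w i - w i0) * ((w j)^* - (w i0)^*)) / (1 - z i * (z j)^*).
  by rewrite -dwi -dwj /pick_kernel; field.
rewrite djE /d /K /pick_kernel.
by field; do ?[apply/andP; split].
Qed.

(** The Schur complement differs from the reduced Pick kernel by a positive scalar and a diagonal
    congruence. Both are invertible, since [d] vanishes at no remaining point, so positivity passes
    in both directions. *)
Lemma psd_on_pick_schur A z w w' i0 : i0 \in A ->
  (forall i, `|z i| < 1) -> {in A, forall i, `|w i| <= 1} -> `|w i0| < 1 ->
  {in A :\ i0, forall i, z i != z i0} ->
  {in A :\ i0, forall i, schur_step (z i) (w i) (z i0) (w i0) (w' i)} ->
  psd_on A (pick_kernel z w) <-> psd_on (A :\ i0) (pick_kernel z w').
Proof.
move=> Ai0 z1 w1 w01 zi0 st.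
pose d k := (1 - (w i0)^* * w k) * (z k - z i0) / (1 - (z i0)^* * z k).
have d0 i : i \in A :\ i0 -> d i != 0.
  move=> iA; have /setD1P[_ Ai] := iA.
  rewrite /d !mulf_neq0 ?invr_eq0 //; last 2 first.
  by rewrite subr_eq0 zi0.
  by rewrite one_subM_neq0 ?norm_conjC_lt1 ?ltW.
by rewrite one_subM_neq0 ?norm_conjC_lt1 ?w1.
have c0 := one_sub_normsq_gt0 w01.
have KE : {in A :\ i0 &, forall i j,
   pick_kernel z w i j - pick_kernel z w i i0 * pick_kernel z w i0 j / pick_kernel z w i0 i0
   = (1 - w i0 * (w i0)^*)^-1 * (d i * (d j)^* * pick_kernel z w' i j)}.
  move=> i j iA jA; apply: pick_kernel_schur => //.
  - by apply: w1; case/setD1P: iA.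
  - by apply: w1; case/setD1P: jA.
  - exact: st.
  - exact: st.
rewrite (psd_on_schur Ai0); first last.
- by move=> j _; apply: pick_kernelC.
- by rewrite divr_gt0 // one_sub_normsq_gt0.
split=> [/(eq_psd_on KE) Kp|Kp]; last first.
  have {}Kp : psd_on (A :\ i0) (fun i j => (1 - w i0 * (w i0)^*)^-1 *
      (d i * (d j)^* * pick_kernel z w' i j)).
    by apply: psd_on_scale; [rewrite invr_ge0 ltW|apply: psd_on_congr].
  by apply: eq_psd_on Kp => i j iA jA; rewrite KE.
have := psd_on_scale (ltW c0) Kp => /(psd_on_congr (fun i => (d i)^-1)).
apply: eq_psd_on => i j /d0 di /d0 dj; rewrite fmorphV /=.
by field; rewrite di conjC_eq0 dj gt_eqF.
Qed.

(** Induction on the number of points. The interpolant [P / Q] is kept as a pair of polynomials, so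
    that [mobius_le] carries the bound through the inverse Schur step without division. *)
Lemma pick_interpolation A z w :
  (forall i, `|z i| < 1) -> {in A &, injective z} ->
  psd_on A (pick_kernel z w) ->
  exists P Q : {poly C},
    (forall x, `|x| < 1 -> Q.[x] != 0 /\ `|P.[x]| <= `|Q.[x]|) /\
    {in A, forall i, P.[z i] = w i * Q.[z i]}.
Proof.
move=> z1; have [m] := ubnP #|A|; elim: m => // m IH in A w *.
rewrite ltnS => Am zI Kp.
have [->|[i0 Ai0]] := set_0Vmem A.
  exists 0, 1; split=> [x _|i]; last by rewrite inE.
  by rewrite !hornerE oner_eq0 normr0.
have w1 i : i \in A -> `|w i| <= 1.
  move=> /(psd_on_diag Kp); rewrite /pick_kernel pmulr_lge0.
    by rewrite -normCK subr_ge0 expr_le1.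
  by rewrite invr_gt0 one_sub_normsq_gt0.
have KC : {in A &, forall i j, pick_kernel z w j i = (pick_kernel z w i j)^*}.
  by move=> i j _ _; apply: pick_kernelC.
(* A unimodular value makes the diagonal entry at [i0] zero, hence its whole row; then all values
   equal [w i0] and a constant interpolates. *)
have [w01|] := boolP (`|w i0| < 1); last first.
  rewrite lt_neqAle w1 // andbT negbK => /eqP w01.
  have w0C : w i0 * (w i0)^* = 1 by rewrite -normCK w01 expr1n.
  exists (w i0)%:P, 1; split=> [x _|i Ai]; rewrite !hornerE ?oner_eq0 ?normr1 ?w01 //.
  have K0 : pick_kernel z w i0 i0 = 0 by rewrite /pick_kernel w0C subrr mul0r.
  have /eqP := psd_on_diag0 Kp KC Ai0 Ai K0.
  rewrite mulf_eq0 invr_eq0 [X in _ || X](negbTE (one_subM_neq0 _ _)) ?norm_conjC_le1 ?ltW //.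
  rewrite orbF subr_eq0 => /eqP H.
  by apply: (can_inj (@conjCK C)); rewrite -[RHS]mul1r -w0C mulrAC -H mul1r.
pose w' i := (w i - w i0) * (1 - (z i0)^* * z i)
             / ((z i - z i0) * (1 - (w i0)^* * w i)).
have zi0 : {in A :\ i0, forall i, z i != z i0}.
  by move=> i /setD1P[ne Ai]; apply: contra_neq ne; apply: zI.
have st : {in A :\ i0, forall i, schur_step (z i) (w i) (z i0) (w i0) (w' i)}.
  move=> i iA; rewrite /schur_step mulrC divfK // mulf_neq0 ?subr_eq0 ?zi0 //.
  have /setD1P[_ Ai] := iA.
  by rewrite -subr_eq0 one_subM_neq0 ?norm_conjC_lt1 ?w1.
have {}Kp := (psd_on_pick_schur Ai0 z1 w1 w01 zi0 st).1 Kp.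
have [||P [Q [PQ PQE]]] := IH (A :\ i0) w' _ _ Kp.
- by rewrite (cardsD1 i0) Ai0 in Am.
- by move=> i j /setD1P[_ Ai] /setD1P[_ Aj]; apply: zI.
(* [U / V] is [P / Q] times the Blaschke factor at [z i0], and [(U + w0 V) / (V + w0^* U)], with
   [w0 = w i0], undoes the Schur step. The factor vanishes at [z i0], where the value is therefore
   [w0]. *)
pose U := ('X - (z i0)%:P) * P; pose V := (1 - (z i0)^* *: 'X) * Q.
have UE x : U.[x] = (x - z i0) * P.[x] by rewrite !hornerE.
have VE x : V.[x] = (1 - (z i0)^* * x) * Q.[x] by rewrite !hornerE.
exists (U + w i0 *: V), (V + (w i0)^* *: U); split=> [x x1|i Ai].
  have [Qx PQx] := PQ x x1; rewrite !hornerD !hornerZ; apply: mobius_le => //.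
    by rewrite VE mulf_neq0 // one_subM_neq0 ?norm_conjC_lt1 // ltW.
  by rewrite UE VE !normrM ler_pM // blaschke_le1 // ltW.
rewrite !hornerD !hornerZ UE VE; have [->|ni0] := eqVneq i i0.
  by rewrite subrr !mul0r mulr0 add0r addr0.
have iA : i \in A :\ i0 by rewrite !inE ni0.
rewrite PQE //; apply/eqP; rewrite -subr_eq0; apply/eqP.
transitivity (((z i - z i0) * (1 - (w i0)^* * w i) * w' i -
  (w i - w i0) * (1 - (z i0)^* * z i)) * Q.[z i]); first by ring.
by rewrite st // subrr mul0r.
Qed.
End Pick.

(* Imported only here because it shadows the names of [finset]. *)
From mathcomp Require Import all_classical all_reals all_analysis.
Import numFieldNormedType.Exports.
Import Normc.
Local Open Scope classical_set_scope.

(** * Taylor expansions of complex functions *)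

Section Modulus.
Variable R : realType.
Local Notation C := R[i].
Implicit Types x y z : C.

Lemma normrE z : `|z| = (normc z)%:C%C.
Proof. by []. Qed.

Lemma normc_ge0 z : 0 <= normc z.
Proof. by case: z => a b /=; apply: sqrtr_ge0. Qed.

Lemma normc_real (a : R) : normc (a%:C)%C = `|a|.
Proof. by rewrite /= expr0n /= addr0 sqrtr_sqr. Qed.

Lemma normc_eq0 z : (normc z == 0) = (z == 0).
Proof. by apply/eqP/eqP => [/eq0_normc|-> ] //; rewrite normc0. Qed.

Lemma normc_gt0 z : (0 < normc z) = (z != 0).
Proof. by rewrite lt_neqAle normc_ge0 andbT eq_sym normc_eq0. Qed.

Lemma normcX z n : normc (z ^+ n) = normc z ^+ n.
Proof. by elim: n => [|n IH]; rewrite ?expr0 ?normc1 // !exprS normcM IH. Qed.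

Lemma le_normcB x y : normc (x - y) <= normc x + normc y.
Proof. by rewrite -(normcN y) le_normcD. Qed.

Lemma normc_sub_le x y : normc x - normc y <= normc (x - y).
Proof. by rewrite lerBlDr -{1}(subrK y x) le_normcD. Qed.

Lemma normc_sum (J : Type) (s : seq J) (P : pred J) (F : J -> C) :
  normc (\sum_(j <- s | P j) F j) <= \sum_(j <- s | P j) normc (F j).
Proof.
elim/big_ind2: _ => [|x a y b xa yb|//]; first by rewrite normc0.
by rewrite (le_trans (le_normcD _ _)) ?lerD.
Qed.

Lemma normc_conj z : normc (z^*)%R = normc z.
Proof. by apply: complexI; rewrite -!normrE norm_conjC. Qed.

Lemma Re_le_normc z : complex.Re z <= normc z.
Proof. by rewrite (le_trans (ler_norm _)) // -lecR normc_ge_Re. Qed.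

Lemma normr_lt1 z : (`|z| < 1) = (normc z < 1).
Proof. by rewrite normrE -ltcR. Qed.

Lemma normr_le1 z : (`|z| <= 1) = (normc z <= 1).
Proof. by rewrite normrE -lecR. Qed.

Lemma normr_le x y : (`|x| <= `|y|) = (normc x <= normc y).
Proof. by rewrite !normrE lecR. Qed.
End Modulus.

(** * Order of vanishing at 0 *)

Section OrdO.
Variable R : realType.
Local Notation C := R[i].
Implicit Types (e f g : C -> C) (p q : {poly C}) (c : C).

(* [e t = O(t ^ n)] as [t] tends to 0.  The point [t = 0] is included, so
   [e 0 = 0] as soon as [n > 0]. *)
Definition ordO (n : nat) e := exists K d : R,
  [/\ 0 <= K, 0 < d & forall t, normc t < d -> normc (e t) <= K * normc t ^+ n].

Lemma ordO_near n e f : (exists2 d : R, 0 < d & forall t, normc t < d -> e t = f t) ->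
  ordO n e -> ordO n f.
Proof.
move=> [d d0 ef] [K [d' [K0 d'0 H]]]; exists K, (Num.min d d'); split=> //.
  by rewrite lt_min d0.
by move=> t; rewrite lt_min => /andP[td td']; rewrite -ef // H.
Qed.

Lemma eq_ordO n e f : e =1 f -> ordO n e -> ordO n f.
Proof. by move=> ef; apply: ordO_near; exists 1. Qed.

Lemma ordOD n e f : ordO n e -> ordO n f -> ordO n (fun t => e t + f t).
Proof.
move=> [K [d [K0 d0 H]]] [K' [d' [K'0 d'0 H']]].
exists (K + K'), (Num.min d d'); split; rewrite ?addr_ge0 ?lt_min ?d0 //.
move=> t; rewrite lt_min => /andP[td td'].
by rewrite mulrDl (le_trans (le_normcD _ _)) // lerD ?H ?H'.
Qed.

Lemma ordOM m n e f : ordO m e -> ordO n f -> ordO (m + n) (fun t => e t * f t).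
Proof.
move=> [K [d [K0 d0 H]]] [K' [d' [K'0 d'0 H']]].
exists (K * K'), (Num.min d d'); split; rewrite ?mulr_ge0 ?lt_min ?d0 //.
move=> t; rewrite lt_min => /andP[td td'].
by rewrite normcM exprD mulrACA ler_pM ?normc_ge0 ?H ?H'.
Qed.

Lemma ordO_leq m n e : (m <= n)%N -> ordO n e -> ordO m e.
Proof.
move=> mn [K [d [K0 d0 H]]]; exists K, (Num.min d 1); split=> //.
  by rewrite lt_min d0 ltr01.
move=> t; rewrite lt_min => /andP[td t1]; rewrite (le_trans (H _ td)) //.
by rewrite ler_wpM2l // ler_wiXn2l ?normc_ge0 // ltW.
Qed.

Lemma ordO_cst (a : C) : ordO 0 (fun=> a).
Proof.
by exists (normc a), 1; split; rewrite ?normc_ge0 // => t _; rewrite expr0 mulr1.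
Qed.

Lemma ordO_id : ordO 1 id.
Proof. by exists 1, 1; split=> // t _; rewrite mul1r. Qed.

Lemma ordO_poly p : ordO 0 (horner p).
Proof.
elim/poly_ind: p => [|p a Hp].
  by apply: eq_ordO (ordO_cst 0) => t; rewrite horner0.
apply: (@eq_ordO _ (fun t => p.[t] * t + a)) => [t|]; first by rewrite !hornerE.
apply: ordOD (ordO_cst _); apply: ordO_leq (ordOM Hp ordO_id); exact: leq0n.
Qed.

Lemma ordOZ n (a : C) e : ordO n e -> ordO n (fun t => a * e t).
Proof. exact: (ordOM (ordO_cst a)). Qed.

Lemma ordOX k n e : ordO n e -> ordO (k * n) (fun t => e t ^+ k).
Proof.
move=> He; elim: k => [|k IH]; first exact: ordO_cst.
by rewrite mulSn; apply: eq_ordO (ordOM He IH) => t; rewrite exprS.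
Qed.

Lemma ordO_at0 n e : ordO n.+1 e -> e 0 = 0.
Proof.
move=> [K [d [K0 d0 H]]]; apply/eqP; rewrite -normc_eq0 eq_le normc_ge0 andbT.
by rewrite (le_trans (H 0 _)) ?normc0 // expr0n mulr0.
Qed.

Lemma ordO0P e : ordO 0 e <->
  exists K d : R, 0 < d /\ forall t, normc t < d -> normc (e t) <= K.
Proof.
split=> [[K [d [K0 d0 H]]]|[K [d [d0 H]]]].
  by exists K, d; split=> // t /H; rewrite mulr1.
have K0 : 0 <= K by rewrite (le_trans (normc_ge0 (e 0))) // H ?normc0.
by exists K, d; split=> // t /H; rewrite mulr1.
Qed.


Lemma exists_small (K d : R) : 0 <= K -> 0 < d ->
  exists2 t : R, 0 < t < d & K * t < 1.
Proof.
move=> K0 d0; exists (Num.min d (K + 1)^-1 / 2).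
  have H : 0 < Num.min d (K + 1)^-1 by rewrite lt_min d0 invr_gt0; lra.
  have : Num.min d (K + 1)^-1 <= d by rewrite ge_min lexx.
  lra.
have H : Num.min d (K + 1)^-1 <= (K + 1)^-1 by rewrite ge_min lexx orbT.
have H1 : (K + 1) * (K + 1)^-1 = 1 by rewrite mulfV //; lra.
have H2 : 0 < (K + 1)^-1 by rewrite invr_gt0; lra.
nra.
Qed.

Lemma small_eq0 (K d : R) (a : C) : 0 <= K -> 0 < d ->
  (forall t, t != 0 -> normc t < d -> normc a <= K * normc t) -> a = 0.
Proof.
move=> K0 d0 H; apply/eqP; rewrite -normc_eq0 eq_le.
rewrite normc_ge0 andbT leNgt; apply/negP => a0.
have [|//|t /andP[t0 td] tK] := exists_small (K := K / normc a) (d := d).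
  by rewrite divr_ge0 ?normc_ge0.
have tE : normc (t%:C)%C = t by rewrite normc_real gtr0_norm.
have := H (t%:C)%C; rewrite tE -normc_eq0 tE gt_eqF // leNgt => /(_ isT td).
by move: tK; rewrite mulrAC ltr_pdivrMr // mul1r => ->.
Qed.

Lemma ordO_mulX0 n e : ordO n.+1 (fun t => e t * t) -> e 0 = 0 -> ordO n e.
Proof.
move=> [K [d [K0 d0 H]]] e0; exists K, d; split=> // t td.
have [->|t0] := eqVneq t 0.
  by rewrite e0 normc0 mulr_ge0 ?exprn_ge0 // normc0.
by have := H t td; rewrite normcM exprSr mulrA ler_pM2r ?normc_gt0.
Qed.

(** Division by [t] is harmless away from 0 but says nothing about [e 0]; the continuity hypothesis
    supplies the missing value, which is 0 when [n > 0]. *)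
Lemma ordO_mulX n e : ordO n.+1 (fun t => e t * t) ->
  ordO 1 (fun t => e t - e 0) -> ordO n e.
Proof.
move=> He He0; have [n0|n_gt0] := posnP n.
  subst n; apply: eq_ordO (ordOD (ordO_leq (leq0n 1) He0) (ordO_cst (e 0))) => t.
  by rewrite subrK.
apply: ordO_mulX0 (He) _.
have [K [d [K0 d0 H]]] := ordO_leq (n_gt0 : (1 < n.+1)%N) He.
have [K' [d' [K'0 d'0 H']]] := He0.
(* For small [t != 0], [|e 0| <= |e t| + |e t - e 0| <= (K + K') |t|]. *)
apply: (@small_eq0 (K + K') (Num.min d d')).
- exact: addr_ge0.
- by rewrite lt_min d0 d'0.
move=> t t0; rewrite lt_min => /andP[td td'].
have := H t td; rewrite normcM expr2 mulrA ler_pM2r ?normc_gt0 // => h1.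
have := H' t td'; have := normc_sub_le (e 0) (e t).
rewrite -[normc (e 0 - e t)]normcN opprB expr1 mulrDl; lra.
Qed.

Lemma ordO_poly_sub p : ordO 1 (fun t => p.[t] - p.[0]).
Proof.
elim/poly_ind: p => [|p a _].
  by apply: eq_ordO (ordOM (ordO_cst 0) ordO_id) => t; rewrite !horner0 mul0r subr0.
by apply: eq_ordO (ordOM (ordO_poly p) ordO_id) => t; rewrite !hornerE; ring.
Qed.

Lemma ordO_coef n p : ordO n (horner p) -> forall j, (j < n)%N -> p`_j = 0.
Proof.
elim: n p => // n IH; elim/poly_ind => [|q a _] Hp j; first by rewrite coef0.
have := ordO_at0 Hp; rewrite hornerMXaddC mulr0 add0r => a0.
rewrite a0 addr0 in Hp *; case: j => [|j] jn; rewrite coefMX //=.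
apply: IH jn; apply: ordO_mulX (ordO_poly_sub q).
by apply: eq_ordO Hp => t; rewrite hornerMX.
Qed.

Lemma ordO_polyXn n p : ordO n (fun t => t ^+ n * p.[t]).
Proof.
by have := ordOM (ordOX n ordO_id) (ordO_poly p); rewrite muln1 addn0.
Qed.
End OrdO.

(** * Finite Taylor expansions and their algebra *)

Section Taylor.
Variable R : realType.
Local Notation C := R[i].
Implicit Types (f g h : C -> C) (p q : {poly C}) (c : C).

(** The degree of [p] is left free, so that products and compositions of expansions need no
    truncation. *)
Definition taylor n g c := exists p, ordO n (fun t => g (c + t) - p.[t]).

Definition smooth g c := forall n, taylor n g c.

Lemma eq_taylor n f g c : f =1 g -> taylor n f c -> taylor n g c.
Proof. by move=> fg [p Hp]; exists p; apply: eq_ordO Hp => t; rewrite fg. Qed.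

Lemma taylor_near n f g c :
  (exists2 d : R, 0 < d & forall t, normc t < d -> f (c + t) = g (c + t)) ->
  taylor n f c -> taylor n g c.
Proof.
move=> [d d0 fg] [p Hp]; exists p; apply: ordO_near Hp.
by exists d => // t td; rewrite fg.
Qed.

Lemma smooth_near f g c :
  (exists2 d : R, 0 < d & forall t, normc t < d -> f (c + t) = g (c + t)) ->
  smooth f c -> smooth g c.
Proof. by move=> fg Hf n; apply: taylor_near (Hf n). Qed.

Lemma taylor_ordO0 n g c : taylor n g c -> ordO 0 (fun t => g (c + t)).
Proof.
move=> [p /(ordO_leq (leq0n n)) Hp].
by apply: eq_ordO (ordOD Hp (ordO_poly p)) => t; rewrite subrK.
Qed.

Lemma taylor_ordO1 n g c : taylor n.+1 g c -> ordO 1 (fun t => g (c + t) - g c).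
Proof.
move=> [p Hp]; have := ordO_at0 Hp; rewrite addr0 => /eqP.
rewrite subr_eq0 => /eqP ->.
apply: eq_ordO (ordOD (ordO_leq (ltn0Sn n) Hp) (ordO_poly_sub p)) => t.
by rewrite addrA subrK.
Qed.

Lemma taylor_eq n f g c :
  taylor n f c -> ordO n (fun t => g (c + t) - f (c + t)) -> taylor n g c.
Proof.
by move=> [p Hp] H; exists p; apply: eq_ordO (ordOD H Hp) => t; rewrite addrA subrK.
Qed.

Lemma taylor_poly n p c : taylor n (horner p) c.
Proof.
exists (p \Po ('X + c%:P)); apply: eq_ordO (ordO_polyXn n 0) => t.
by rewrite horner_comp !hornerE [t + c]addrC subrr.
Qed.

Lemma taylor_cst n (a : C) c : taylor n (fun=> a) c.
Proof. by apply: eq_taylor (taylor_poly n a%:P c) => t; rewrite hornerC. Qed.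

Lemma taylorD n f g c : taylor n f c -> taylor n g c ->
  taylor n (fun z => f z + g z) c.
Proof.
move=> [p Hp] [q Hq]; exists (p + q); apply: eq_ordO (ordOD Hp Hq) => t.
by rewrite hornerD; ring.
Qed.

Lemma taylorM n f g c : taylor n f c -> taylor n g c ->
  taylor n (fun z => f z * g z) c.
Proof.
move=> [p Hp] [q Hq]; exists (p * q).
have Hg : ordO 0 (fun t => g (c + t)) by apply: (@taylor_ordO0 n); exists q.
have := ordOD (ordOM Hg Hp) (ordOM (ordO_poly p) Hq); rewrite !add0n.
by apply: eq_ordO => t; rewrite hornerM; ring.
Qed.

Lemma taylorX k n f c : taylor n f c -> taylor n (fun z => f z ^+ k) c.
Proof.
move=> Hf; elim: k => [|k IH]; first exact: taylor_cst.
by apply: eq_taylor (taylorM Hf IH) => t; rewrite exprS.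
Qed.

Lemma taylor_sum k n (F : nat -> C -> C) c : (forall j, taylor n (F j) c) ->
  taylor n (fun z => \sum_(j < k) F j z) c.
Proof.
move=> HF; elim: k => [|k IH].
  by apply: eq_taylor (taylor_cst n 0 c) => t; rewrite big_ord0.
by apply: eq_taylor (taylorD IH (HF k)) => t; rewrite big_ord_recr.
Qed.

Lemma taylor_away n g c : taylor n.+1 g c -> g c != 0 -> exists2 s : R, 0 < s &
  forall t, normc t < s -> normc (g c) / 2 <= normc (g (c + t)).
Proof.
move=> /taylor_ordO1[K [d [K0 d0 H]]] g0.
have n0 : 0 < normc (g c) by rewrite normc_gt0.
have [|//|s /andP[s0 sd] sK] := exists_small (K := 2 * K / normc (g c)) (d := d).
  by rewrite divr_ge0 ?mulr_ge0 // ltW.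
exists s => // t ts; have := H t (lt_trans ts sd).
have := normc_sub_le (g c) (g (c + t)).
rewrite -[normc (g c - _)]normcN opprB expr1 => h1 h2.
move: sK; rewrite mulrAC ltr_pdivrMr // mul1r => sK.
have : K * normc t <= K * s by rewrite ler_wpM2l // ltW.
lra.
Qed.

Lemma ordO0_inv g c n : taylor n.+1 g c -> g c != 0 -> ordO 0 (fun t => (g (c + t))^-1).
Proof.
move=> Hg g0; have [s s0 H] := taylor_away Hg g0; apply/ordO0P.
have n0 : 0 < normc (g c) / 2 by rewrite divr_gt0 ?normc_gt0.
exists (normc (g c) / 2)^-1, s; split=> // t /H Ht.
by rewrite normcV lef_pV2 // posrE (lt_le_trans n0).
Qed.

(** Geometric series: with [v = 1 - g / g c], which is [O(t)], the inverse of [g] is [(g c)^-1]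
    times the sum of [v ^ j] for [j < n], up to the error [v ^ n / g = O(t ^ n)]. *)
Lemma smoothV g c : smooth g c -> g c != 0 -> smooth (fun z => (g z)^-1) c.
Proof.
move=> Hg g0 n; pose v z := 1 - (g c)^-1 * g z.
have Hv m : taylor m v c.
  have : taylor m (fun z => 1 + (- (g c)^-1) * g z) c.
    by apply: taylorD (taylor_cst _ _ _) _; apply: taylorM (taylor_cst _ _ _) (Hg m).
  by apply: eq_taylor => t; rewrite /v mulNr.
have vO : ordO 1 (fun t => v (c + t)).
  apply: eq_ordO (taylor_ordO1 (Hv 1)) => t.
  by rewrite [v c]/v mulVf // subrr subr0.
apply: (@taylor_eq _ (fun z => (g c)^-1 * \sum_(j < n) v z ^+ j)).
  apply: taylorM (taylor_cst _ _ _) _.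
  by apply: (@taylor_sum n n (fun j z => v z ^+ j)) => j; apply: taylorX.
have := ordOM (ordO0_inv (Hg 1) g0) (ordOX n vO); rewrite muln1 add0n.
have [s s0 H] := taylor_away (Hg 1) g0.
apply: ordO_near; exists s => // t /H gt.
have gt0 : g (c + t) != 0.
  by rewrite -normc_gt0 (lt_le_trans _ gt) // divr_gt0 ?normc_gt0.
have := subrX1 (v (c + t)) n.
have -> : v (c + t) - 1 = - ((g c)^-1 * g (c + t)) by rewrite /v addrAC subrr add0r.
move=> /(canRL (subrK _)) ->; field; by rewrite g0 gt0.
Qed.

Lemma smooth_poly p c : smooth (horner p) c.
Proof. by move=> n; apply: taylor_poly. Qed.

Lemma smooth_cst (a : C) c : smooth (fun=> a) c.
Proof. by move=> n; apply: taylor_cst. Qed.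

Lemma smoothM f g c : smooth f c -> smooth g c -> smooth (fun z => f z * g z) c.
Proof. by move=> Hf Hg n; apply: taylorM. Qed.

Lemma smoothB f g c : smooth f c -> smooth g c -> smooth (fun z => f z - g z) c.
Proof.
move=> Hf Hg n; have := taylorD (Hf n) (taylorM (taylor_cst n (- 1) c) (Hg n)).
by apply: eq_taylor => z; rewrite mulN1r.
Qed.

(** Removable singularity: every expansion of [F] at [a] has zero constant term and can be divided
    by [t], at the cost of one order. *)
Lemma smooth_div_root F a : smooth F a -> F a = 0 ->
  exists b, smooth (fun z => if z == a then b else F z / (z - a)) a.
Proof.
move=> HF Fa.
have tayX n : exists p, ordO n.+1 (fun t => F (a + t) - p.[t] * t).
  have [p Hp] := HF n.+1; elim/poly_ind: p Hp => [|p x _] Hp.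
    by exists 0; apply: eq_ordO Hp => t; rewrite !horner0 mul0r.
  exists p; have := ordO_at0 Hp; rewrite addr0 Fa hornerMXaddC mulr0 !add0r => /eqP.
  rewrite oppr_eq0 => /eqP x0; apply: eq_ordO Hp => t.
  by rewrite hornerMXaddC x0 addr0.
have [q Hq] := tayX 1; exists q.[0] => n.
have [p Hp] := tayX n.+1.
(* The filling value is taken from the expansion of order 2; uniqueness of coefficients makes it
   agree with the expansions of all higher orders. *)
have pq : p.[0] = q.[0].
  have H : ordO 2 (horner ((p - q) * 'X)).
    apply: eq_ordO (ordOD (ordOZ (- 1) (ordO_leq (isT : (1 < n.+2)%N) Hp)) Hq) => t.
    by rewrite hornerMX hornerD hornerN; ring.
  have := ordO_coef H (isT : (1 < 2)%N); rewrite coefMX /= -horner_coef0 hornerD hornerN.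
  by move/eqP; rewrite subr_eq0 => /eqP.
exists p; apply: ordO_leq (leqnSn n) _; apply: ordO_mulX0.
  apply: eq_ordO Hp => t.
  have [->|t0] := eqVneq t 0; first by rewrite !mulr0 addr0 Fa subr0.
  have aE : a + t - a = t by rewrite addrAC subrr add0r.
  by rewrite -subr_eq0 aE (negbTE t0) mulrBl divfK.
by rewrite addr0 eqxx pq subrr.
Qed.
End Taylor.

(** * The maximum principle *)

Section MaximumPrinciple.
Variable R : realType.
Local Notation C := R[i].
Implicit Types (g : C -> C) (c x y z : C).

Lemma normc_sqr z : normc z ^+ 2 = complex.Re z ^+ 2 + complex.Im z ^+ 2.
Proof. by case: z => a b /=; rewrite sqr_sqrtr // addr_ge0 ?sqr_ge0. Qed.

Lemma normc_parallelogram x y :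
  normc (x + y) ^+ 2 + normc (x - y) ^+ 2 = 2 * (normc x ^+ 2 + normc y ^+ 2).
Proof. by rewrite !normc_sqr; case: x => a b; case: y => a' b' /=; ring. Qed.

Lemma ReD x y : complex.Re (x + y) = complex.Re x + complex.Re y.
Proof. by case: x; case: y. Qed.

Lemma ReN x : complex.Re (- x) = - complex.Re x.
Proof. by case: x. Qed.

Lemma normc_le_add (a b : R) : normc (a +i* b)%C <= `|a| + `|b|.
Proof.
rewrite -(ler_pXn2r (n := 2)) ?nnegrE ?normc_ge0 ?addr_ge0 // normc_sqr /=.
rewrite -(real_normK (num_real a)) -(real_normK (num_real b)).
have := normr_ge0 a; have := normr_ge0 b; nra.
Qed.

Lemma taylor3 g c : taylor 3 g c -> exists a b : C,
  ordO 3 (fun t => g (c + t) - (g c + a * t + b * t ^+ 2)).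
Proof.
move=> [p Hp]; have := ordO_at0 Hp; rewrite addr0 => /eqP.
rewrite subr_eq0 => /eqP gc; exists p`_1, p`_2.
apply: eq_ordO (ordOD Hp (ordO_polyXn 3 (drop_poly 3 p))) => t.
rewrite -{1}(poly_take_drop 3 p) hornerD hornerM hornerXn /take_poly horner_poly.
by rewrite !big_ord_recr big_ord0 /= gc horner_coef0; ring.
Qed.

(* The average of [Re g] over [c + s], [c - s], [c + i s], [c - i s] is
   [Re (g c) + O(s ^ 3)], whereas that of the square of the modulus exceeds
   [|c| ^ 2] by exactly [s ^ 2]. *)
Lemma four_point_mean g c (e d : R) : smooth g c -> 0 < e -> 0 < d ->
  (forall t, normc t < d ->
    complex.Re (g (c + t)) + e * normc (c + t) ^+ 2
    <= complex.Re (g c) + e * normc c ^+ 2) -> False.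
Proof.
move=> Hg e0 d0 H; have [a [b [K [d' [K0 d'0 HK]]]]] := taylor3 (Hg 3).
(* The step size is such that [K * s < e], so that the cubic error [K * s ^ 3] is beaten by the gain
   [e * s ^ 2]. *)
have [||s /andP[s0]] := exists_small (K := K / e) (d := Num.min d d').
- by rewrite divr_ge0 // ltW.
- by rewrite lt_min d0.
rewrite lt_min => /andP[sd sd']; rewrite mulrAC ltr_pdivrMr // mul1r => sK.
pose t1 : C := (s%:C)%C; pose t2 : C := 'i%C * t1.
have n1 : normc t1 = s by rewrite normc_real gtr0_norm.
have n2 : normc t2 = s by rewrite normcM n1 /= expr0n expr1n add0r sqrtr1 mul1r.
have := H t1; have := H (- t1); have := H t2; have := H (- t2).
have := HK t1; have := HK (- t1); have := HK t2; have := HK (- t2).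
rewrite !normcN n1 n2.
move=> /(_ sd') k4 /(_ sd') k3 /(_ sd') k2 /(_ sd') k1.
move=> /(_ sd) h4 /(_ sd) h3 /(_ sd) h2 /(_ sd) h1.
(* In the four-point sum the linear terms cancel between opposite points, and the quadratic ones by
   this identity. *)
have t12 : t1 ^+ 2 + t2 ^+ 2 = 0.
  by rewrite /t2 exprMn sqr_i mulN1r subrr.
have esum : 4 * complex.Re (g c) - 4 * (K * s ^+ 3) <=
    complex.Re (g (c + t1)) + complex.Re (g (c - t1))
    + complex.Re (g (c + t2)) + complex.Re (g (c - t2)).
  pose E t := g (c + t) - (g c + a * t + b * t ^+ 2).
  have ReE t : complex.Re (g c) + complex.Re (a * t + b * t ^+ 2) - normc (E t)
      <= complex.Re (g (c + t)).
    have := Re_le_normc (- E t); rewrite normcN /E !(ReN, ReD); lra.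
  have Et : complex.Re (a * t1 + b * t1 ^+ 2) + complex.Re (a * - t1 + b * (- t1) ^+ 2)
      + complex.Re (a * t2 + b * t2 ^+ 2) + complex.Re (a * - t2 + b * (- t2) ^+ 2) = 0.
    rewrite -!ReD; have -> : 0 = complex.Re (2 * b * (t1 ^+ 2 + t2 ^+ 2)).
      by rewrite t12 mulr0.
    by congr complex.Re; ring.
  have := ReE t1; have := ReE (- t1); have := ReE t2; have := ReE (- t2).
  rewrite /E; lra.
have := normc_parallelogram c t1; have := normc_parallelogram c t2.
rewrite n1 n2 => nsum2 nsum1.
have : 4 * e * s ^+ 2 <= 4 * (K * s ^+ 3) by nra.
have -> : 4 * (K * s ^+ 3) = 4 * (K * s) * s ^+ 2 by ring.
by rewrite ler_pM2r ?exprn_gt0 //; lra.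
Qed.

Lemma Re_continuous g c (p : R * R) : smooth g c -> c = (p.1 +i* p.2)%C ->
  {for p, continuous (fun q : R * R => complex.Re (g (q.1 +i* q.2)%C))}.
Proof.
move=> Hg cp; have [K [d [K0 d0 H]]] := taylor_ordO1 (Hg 1).
apply/cvgrPdist_lt => e e0.
(* The factors 2 appear because a point of the square of half-side [s] is within distance [2 * s] of
   its centre. *)
have [||s /andP[s0 sd]] := exists_small (K := 2 * K / e) (d := d / 2).
- by rewrite divr_ge0 ?mulr_ge0 // ltW.
- by rewrite divr_gt0.
rewrite mulrAC ltr_pdivrMr // mul1r => sK.
exists (ball p.1 s, ball p.2 s) => /= [|q [/= b1 b2]].
  by split; apply: nbhsx_ballx.
pose t : C := ((q.1 - p.1) +i* (q.2 - p.2))%C.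
have ct : (q.1 +i* q.2)%C = c + t :> C.
  rewrite cp /t; apply/eqP; rewrite eq_complex /=.
  by rewrite ![p.1 + _]addrC ![p.2 + _]addrC !subrK !eqxx.
have nt : normc t < 2 * s.
  rewrite (le_lt_trans (normc_le_add _ _)) // distrC [X in _ + X]distrC.
  by move: b1 b2; rewrite /ball /=; lra.
rewrite ct -cp distrC.
have -> : complex.Re (g (c + t)) - complex.Re (g c) = complex.Re (g (c + t) - g c).
  by case: (g (c + t)) => x y; case: (g c).
rewrite (@le_lt_trans _ _ (normc (g (c + t) - g c))) //.
  by rewrite -lecR normc_ge_Re.
have td : normc t < d by lra.
rewrite (le_lt_trans (H t td)) // expr1; nra.
Qed.

Definition closed_disk2 (r : R) : set (R * R) := [set q | q.1 ^+ 2 + q.2 ^+ 2 <= r ^+ 2].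

Lemma sqnorm_continuous : continuous (fun q : R * R => q.1 ^+ 2 + q.2 ^+ 2).
Proof.
move=> p; apply: cvgD; rewrite expr2; apply: cvgM.
all: by [exact: cvg_fst | exact: cvg_snd].
Qed.

Lemma compact_closed_disk2 r : 0 < r -> compact (closed_disk2 r).
Proof.
move=> r0; apply: (@subclosed_compact _ _ (`[- r, r] `*` `[- r, r])).
- rewrite (_ : closed_disk2 r =
    (fun q : R * R => q.1 ^+ 2 + q.2 ^+ 2) @^-1` [set x | x <= r ^+ 2]) //.
  by apply: preimage_closed (@closed_le _ _) => p _; apply: sqnorm_continuous.
- by apply: compact_setX; apply: segment_compact.
move=> [x y]; rewrite /closed_disk2 /= !in_itv /= => H.
by split; apply/andP; split; nra.
Qed.

(* The perturbed function [Re g + e |z|^2] attains its maximum on the closed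
   disk, and by the previous lemma it does so on the circle. *)
Lemma maximum_Re g (r B : R) : 0 < r ->
  (forall z, normc z <= r -> smooth g z) ->
  (forall z, normc z = r -> complex.Re (g z) <= B) ->
  forall z, normc z <= r -> complex.Re (g z) <= B.
Proof.
move=> r0 Hg HB z zr; apply/ler_addgt0Pr => e e0.
(* With this weight the perturbation is at most [e] on the disk, and equal to it on the circle. *)
pose e' := e / r ^+ 2; have e'0 : 0 < e' by rewrite divr_gt0 ?exprn_gt0.
pose F (q : R * R) := complex.Re (g (q.1 +i* q.2)%C) + e' * (q.1 ^+ 2 + q.2 ^+ 2).
have inD w : normc w <= r -> closed_disk2 r (complex.Re w, complex.Im w).
  by rewrite /closed_disk2 /= -normc_sqr ler_pXn2r ?nnegrE ?normc_ge0 ?(ltW r0).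
have ofD q : closed_disk2 r q -> normc (q.1 +i* q.2)%C <= r.
  have E : normc (q.1 +i* q.2)%C ^+ 2 = q.1 ^+ 2 + q.2 ^+ 2 by exact: normc_sqr.
  rewrite -(ler_pXn2r (n := 2)) ?nnegrE ?normc_ge0 ?(ltW r0) // E.
  exact.
have FE w : F (complex.Re w, complex.Im w) = complex.Re (g w) + e' * normc w ^+ 2.
  by rewrite /F normc_sqr; case: w.
have [||q qD qmax] := @compact_EVT_max _ _ F _ _ (compact_closed_disk2 r0).
- by exists (complex.Re z, complex.Im z); apply: inD.
- apply: continuous_in_subspaceT => q /set_mem /ofD qD.
  apply: cvgD; first exact: (Re_continuous (Hg _ qD)).
  by apply: cvgM; [exact: cvg_cst | exact: sqnorm_continuous].
have {}qD := ofD _ (set_mem qD); pose c := (q.1 +i* q.2)%C : C.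
have {}qmax w : normc w <= r -> complex.Re (g w) + e' * normc w ^+ 2 <=
    complex.Re (g c) + e' * normc c ^+ 2.
  move=> wr; rewrite -!FE /c /= -surjective_pairing; apply: qmax.
  by apply/mem_set/inD.
have cr : normc c = r.
  apply/eqP; rewrite eq_le qD /= leNgt; apply/negP => cr.
  apply: (@four_point_mean g c e' (r - normc c)) => //.
  - exact: Hg.
  - by rewrite subr_gt0.
  move=> t tr; apply: qmax; rewrite (le_trans (le_normcD _ _)) //; lra.
have := qmax z zr; have := HB c cr; rewrite cr => h1 h2.
have e're : e' * r ^+ 2 = e by rewrite divfK // gt_eqF ?exprn_gt0.
have : 0 <= e' * normc z ^+ 2 by rewrite mulr_ge0 ?exprn_ge0 ?normc_ge0 // ltW.
lra.
Qed.

(** For fixed [z], the function [(g z)^* * g] has real part [|g z|^2] at [z] and at most [|g z| * B]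
    on the circle, so the principle for real parts applies. *)
Lemma maximum_modulus g (r B : R) : 0 < r -> 0 <= B ->
  (forall z, normc z <= r -> smooth g z) ->
  (forall z, normc z = r -> normc (g z) <= B) ->
  forall z, normc z <= r -> normc (g z) <= B.
Proof.
move=> r0 B0 Hg HB z zr; have [->|gz] := eqVneq (g z) 0; first by rewrite normc0.
have gz0 : 0 < normc (g z) by rewrite normc_gt0.
rewrite -(ler_pM2l gz0).
have -> : normc (g z) * normc (g z) = complex.Re ((g z)^* * g z).
  by rewrite -expr2 normc_sqr; case: (g z) => x y /=; ring.
apply: (@maximum_Re (fun w => (g z)^* * g w) r _ r0) zr => w wr.
  by apply: smoothM; [exact: smooth_cst | exact: Hg].
by rewrite (le_trans (Re_le_normc _)) // normcM normc_conj ler_wpM2l ?HB // ltW.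
Qed.
End MaximumPrinciple.

(** * The Schwarz lemma and necessity of the Pick condition *)

Section SchurClass.
Variable R : realType.
Local Notation C := R[i].
Implicit Types (f g h : C -> C) (a c z : C).

Definition schur_class f :=
  (forall z, normc z < 1 -> smooth f z) /\ (forall z, normc z < 1 -> normc (f z) <= 1).

(** Stands for the limit as [s] decreases to 0. *)
Lemma le1_of_linear_decay (x y s0 : R) : 0 < s0 ->
  (forall s, 0 < s < s0 -> x - y * s <= 1) -> x <= 1.
Proof.
move=> s00 H; rewrite leNgt; apply/negP => x1.
have [|//|s s0s sK] := exists_small (K := `|y| / (x - 1)) (d := s0).
  by rewrite divr_ge0 // subr_ge0 ltW.
have {}sK : `|y| * s < x - 1.
  by move: sK; rewrite mulrAC ltr_pdivrMr ?mul1r // subr_gt0.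
have := H s s0s; have := ler_norm y; case/andP: s0s => h1 h2.
nra.
Qed.

(** From [|1 - a^* z|^2 - |z - a|^2 = (1 - |a|^2) (1 - |z|^2)], using [|1 - a^* z| >= 1 - |a|] and
    the crude bound [1 - |a|^2 <= 2]. *)
Lemma blaschke_sqr_ge a z : normc a < 1 -> normc z < 1 ->
  1 - 2 / (1 - normc a) ^+ 2 * (1 - normc z ^+ 2)
    <= normc ((z - a) / (1 - a^* * z)) ^+ 2.
Proof.
move=> a1 z1.
have d0 : 0 < 1 - normc a by rewrite subr_gt0.
have dz : 1 - normc a <= normc (1 - a^* * z).
  rewrite (le_trans _ (normc_sub_le _ _)) // normc1 normcM normc_conj.
  have := normc_ge0 a; have := normc_ge0 z; nra.
have dz0 : 0 < normc (1 - a^* * z) by apply: lt_le_trans dz.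
have E : normc (z - a) ^+ 2 = normc (1 - a^* * z) ^+ 2
    - (1 - normc a ^+ 2) * (1 - normc z ^+ 2).
  rewrite !normc_sqr; case: (a) => x y; case: (z) => x' y' /=; ring.
rewrite normcM normcV exprMn exprVn E mulrBl divff ?gt_eqF ?exprn_gt0 //.
rewrite lerD2l lerN2 mulrAC ler_wpM2r //.
  by rewrite subr_ge0 expr_le1 ?normc_ge0 // ltW.
have : 1 - normc a ^+ 2 <= 2 by have := sqr_ge0 (normc a); lra.
move=> h; rewrite ler_pM // ?invr_ge0 ?exprn_ge0 ?normc_ge0 //.
  by rewrite subr_ge0 expr_le1 ?normc_ge0 // ltW.
by rewrite lef_pV2 ?posrE ?exprn_gt0 // lerXn2r ?nnegrE // ltW.
Qed.

Lemma one_sub_conjM_neq0 a z : normc a < 1 -> normc z <= 1 -> 1 - a^* * z != 0.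
Proof.
by move=> a1 z1; rewrite one_subM_neq0 ?norm_conjC ?normr_lt1 ?normr_le1.
Qed.

Lemma smooth_one_subM a c : smooth (fun z => 1 - a^* * z) c.
Proof.
apply: smoothB (smooth_cst _ _) _; apply: smoothM (smooth_cst _ _) _.
by move=> n; apply: eq_taylor (taylor_poly n 'X c) => z; rewrite hornerX.
Qed.

Lemma smooth_id c : smooth (fun z : C => z) c.
Proof. by move=> n; apply: eq_taylor (taylor_poly n 'X c) => z; rewrite hornerX. Qed.

(* On the circle of radius [r] the quotient is at most the inverse of a Blaschke
   factor, which tends to 1 with [r]. *)
Lemma schwarz_division F a : schur_class F -> normc a < 1 -> F a = 0 ->
  exists2 G, schur_class G &
    forall z, normc z < 1 -> (z - a) * G z = (1 - a^* * z) * F z.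
Proof.
move=> [Fs F1] a1 Fa.
have [b Hb] := smooth_div_root (Fs a a1) Fa.
pose Q z := if z == a then b else F z / (z - a).
have Qs z : normc z < 1 -> smooth Q z.
  move=> z1; have [->//|za] := eqVneq z a.
  have : smooth (fun x => F x * (x - a)^-1) z.
    apply: smoothM (Fs z z1) _; apply: smoothV; last by rewrite subr_eq0.
    by apply: smoothB (smooth_id _) (smooth_cst _ _).
  apply: smooth_near; exists (normc (z - a)); first by rewrite normc_gt0 subr_eq0.
  move=> t tz; rewrite /Q ifN //; apply: contraTneq tz => zt.
  by rewrite -zt opprD addrA subrr sub0r normcN ltxx.
pose G z := (1 - a^* * z) * Q z.
have Gs z : normc z < 1 -> smooth G z.
  by move=> z1; apply: smoothM (smooth_one_subM _ _) (Qs z z1).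
have GF z : (z - a) * G z = (1 - a^* * z) * F z.
  rewrite /G /Q; have [->|za] := eqVneq z a; first by rewrite subrr mul0r Fa mulr0.
  by field; rewrite subr_eq0.
exists G => //; split=> // z z1.
rewrite -(ler_pXn2r (n := 2)) ?nnegrE ?normc_ge0 // expr1n.
pose k := 2 / (1 - normc a) ^+ 2.
have k0 : 0 <= k by rewrite divr_ge0 // exprn_ge0 // subr_ge0 ltW.
(* The target is [|G z|^2 (1 - 2 k s) <= 1], from the maximum principle on radius [r = 1 - s]: there
   [|G|^2 (1 - k (1 - r^2)) <= 1], and [1 - r^2 <= 2 s]. The range of [s] ensures [|z| <= r]. *)
apply: (@le1_of_linear_decay _ (normc (G z) ^+ 2 * (k * 2)) (1 - normc z)).
  by rewrite subr_gt0.
move=> s /andP[s0 sz]; pose r := 1 - s.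
have r0 : 0 < r by have := normc_ge0 z; rewrite /r; lra.
have zr : normc z <= r by rewrite /r; lra.
have r1 : r < 1 by rewrite /r; lra.
have sr : 1 - r ^+ 2 <= 2 * s by rewrite /r; nra.
(* If the Blaschke lower bound is not positive it gives nothing on the circle, but then
   [1 - 2 k s <= 0] and the target is trivial. *)
have [q0|q0] := lerP (1 - k * (1 - r ^+ 2)) 0.
  rewrite (@le_trans _ _ 0) //.
  have -> : normc (G z) ^+ 2 - normc (G z) ^+ 2 * (k * 2) * s
     = normc (G z) ^+ 2 * (1 - k * (2 * s)) by ring.
  rewrite mulr_ge0_le0 ?exprn_ge0 ?normc_ge0 //.
  have : k * (1 - r ^+ 2) <= k * (2 * s) by rewrite ler_wpM2l.
  lra.
set q := 1 - k * (1 - r ^+ 2) in q0.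
have : normc (G z) <= Num.sqrt q^-1.
  apply: (maximum_modulus r0) zr => [|w wr|w wr]; first exact: sqrtr_ge0.
    by apply: Gs; apply: le_lt_trans wr r1.
  have w1 : normc w < 1 by rewrite wr.
  have wa := blaschke_sqr_ge a1 w1; rewrite wr -/k -/q in wa.
  rewrite -(ler_pXn2r (n := 2)) ?nnegrE ?normc_ge0 ?sqrtr_ge0 //.
  rewrite sqr_sqrtr ?invr_ge0 ?(ltW q0) // -[X in _ <= X]mul1r ler_pdivlMr //.
  rewrite (le_trans (ler_wpM2l _ wa)) ?exprn_ge0 ?normc_ge0 //.
  rewrite -exprMn -normcM mulrA [G w * _]mulrC GF mulrC mulKf.
    by rewrite expr_le1 ?normc_ge0 // F1.
  by rewrite one_sub_conjM_neq0 // ltW.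
rewrite -(ler_pXn2r (n := 2)) ?nnegrE ?normc_ge0 ?sqrtr_ge0 //.
rewrite sqr_sqrtr ?invr_ge0 ?(ltW q0) // -[X in _ <= X]mul1r ler_pdivlMr // => H.
apply: le_trans H.
have -> : normc (G z) ^+ 2 - normc (G z) ^+ 2 * (k * 2) * s
   = normc (G z) ^+ 2 * (1 - k * (2 * s)) by ring.
by rewrite ler_wpM2l ?exprn_ge0 ?normc_ge0 // /q lerD2l lerN2 ler_wpM2l.
Qed.

Lemma schur_class_mobius f b : schur_class f -> normc b < 1 ->
  schur_class (fun z => (f z - b) / (1 - b^* * f z)).
Proof.
move=> [fs f1] b1; split=> z z1.
  apply: smoothM; first by apply: smoothB (fs z z1) (smooth_cst _ _).
  apply: smoothV; last by rewrite one_sub_conjM_neq0 // f1.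
  by apply: smoothB (smooth_cst _ _) _; apply: smoothM (smooth_cst _ _) (fs z z1).
have d0 : 1 - b^* * f z != 0 by rewrite one_sub_conjM_neq0 // f1.
rewrite normcM normcV ler_pdivrMr ?normc_gt0 // mul1r -normr_le.
by rewrite blaschke_le1 ?normr_le1 ?normr_lt1 // f1.
Qed.

Lemma schur_class_scale f (r : R) : 0 <= r <= 1 -> schur_class f ->
  schur_class (fun z => (r%:C)%C * f z).
Proof.
move=> /andP[r0 r1] [fs f1]; split=> z z1.
  by apply: smoothM (smooth_cst _ _) (fs z z1).
by rewrite normcM normc_real ger0_norm // mulr_ile1 ?normc_ge0 ?f1.
Qed.

Lemma schur_class_step f a : schur_class f -> normc a < 1 -> normc (f a) < 1 ->
  exists2 g, schur_class g &
    forall z, normc z < 1 -> schur_step z (f z) a (f a) (g z).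
Proof.
move=> Hf a1 fa1; have Hm := schur_class_mobius Hf fa1.
have [|g Hg gE] := schwarz_division Hm a1; first by rewrite subrr mul0r.
exists g => // z z1; rewrite /schur_step mulrAC gE //.
have f1 : normc (f z) <= 1 by case: Hf => _ ->.
by field; rewrite one_sub_conjM_neq0.
Qed.

(** The Schwarz lemma at 0, iterated: each division by [z] keeps the bound 1 and lowers the order of
    vanishing by one. *)
Lemma schur_class_root0 f m : schur_class f -> ordO m f ->
  exists2 g, schur_class g & forall z, normc z < 1 -> f z = z ^+ m * g z.
Proof.
elim: m f => [|m IH] f Hf Of; first by exists f => // z _; rewrite mul1r.
have n0 : normc (0 : C) < 1 by rewrite normc0.
have [g Hg gE] := schwarz_division Hf n0 (ordO_at0 Of).
have {}gE z : normc z < 1 -> f z = z * g z.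
  by move=> /gE; rewrite subr0 conjC0 mul0r subr0 mul1r.
have [|h Hh hE] := IH g Hg.
  apply: ordO_mulX.
    apply: ordO_near Of; exists 1 => // t t1; by rewrite gE // mulrC.
  by have := taylor_ordO1 (Hg.1 0 n0 1); apply: eq_ordO => t; rewrite add0r.
by exists h => // z z1; rewrite gE // hE // exprS mulrA.
Qed.

Lemma ge0_of_lt1 (S T : C) :
  (forall r : R, 0 <= r < 1 -> 0 <= S - (r%:C)%C ^+ 2 * T) -> 0 <= S - T.
Proof.
move=> H.
have HE r : 0 <= r < 1 -> complex.Im S - r ^+ 2 * complex.Im T = 0 /\
    0 <= complex.Re S - r ^+ 2 * complex.Re T.
  move=> /H; rewrite lecE -rmorphXn /=; case: (S) => a b; case: (T) => a' b' /=.
  by rewrite !mul0r addr0 subr0 => /andP[/eqP -> ->].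
(* The order on complex numbers also asserts reality; the samples [r = 0] and [r = 1/2] show that
   [S] and [T] are real. *)
have [S1 S2] : complex.Im S - 0 ^+ 2 * complex.Im T = 0 /\
    0 <= complex.Re S - 0 ^+ 2 * complex.Re T by apply: HE; rewrite lexx ltr01.
have [S3 S4] : complex.Im S - (1 / 2) ^+ 2 * complex.Im T = 0 /\
    0 <= complex.Re S - (1 / 2) ^+ 2 * complex.Re T by apply: HE; lra.
have {}S2 : 0 <= complex.Re S by lra.
have I0 : complex.Im S - complex.Im T = 0 by lra.
suff R0 : complex.Re T <= complex.Re S.
  rewrite lecE; move: I0 R0; case: (S) => a b; case: (T) => a' b' /= -> h.
  by rewrite eqxx subr_ge0.
rewrite leNgt; apply/negP => TS.
(* If [Re T > Re S], take [r = 1 - s] with [2 s Re T < Re T - Re S]; then [Re S - r^2 Re T] is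
   negative. *)
have [||s /andP[s0 s1]] := exists_small
  (K := 2 * complex.Re T / (complex.Re T - complex.Re S)) (d := 1) => //.
  by rewrite divr_ge0 //; lra.
rewrite mulrAC ltr_pdivrMr ?subr_gt0 // mul1r => sK.
have [|_] := HE (1 - s); first by lra.
have : 0 <= s ^+ 2 * complex.Re T by rewrite mulr_ge0 ?sqr_ge0 //; lra.
nra.
Qed.

(** Isolates the dependence on [r], so that [ge0_of_lt1] can let [r] tend to 1. *)
Lemma qform_pick_scale (I : finType) (z w x : I -> C) (A : {set I}) (r : R) :
  qform A (pick_kernel z (fun i => (r%:C)%C * w i)) x =
  qform A (fun i j => (1 - z i * (z j)^*)^-1) x
  - (r%:C)%C ^+ 2 * qform A (fun i j => w i * (w j)^* / (1 - z i * (z j)^*)) x.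
Proof.
have rC : ((r%:C)%C : C)^* = (r%:C)%C by rewrite conj_Creal // complex_real.
rewrite mulr_sumr -sumrB; apply: eq_bigr => i _.
rewrite mulr_sumr -sumrB; apply: eq_bigr => j _.
rewrite /pick_kernel rmorphM /= rC; ring.
Qed.

(* Working with [r f] for [r < 1] makes all values strictly smaller than 1, as
   the reduction step requires. *)
Lemma pick_necessary (I : finType) (z : I -> C) f (A : {set I}) :
  (forall i, normc (z i) < 1) -> {in A &, injective z} -> schur_class f ->
  psd_on A (pick_kernel z (f \o z)).
Proof.
move=> z1; have [m] := ubnP #|A|; elim: m => // m IH in A f *.
rewrite ltnS => Am zI Hf.
have [->|[i0 Ai0]] := set_0Vmem A; first by move=> x; rewrite /qform big_set0.
move=> x; have := qform_pick_scale z (f \o z) x A 1.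
rewrite expr1n mul1r => E.
have -> : pick_kernel z (f \o z) = pick_kernel z (fun i => (1%:C)%C * (f \o z) i).
  by apply/funext => i; apply/funext => j; rewrite /pick_kernel !mul1r.
rewrite E; apply: ge0_of_lt1 => r /andP[r0 r1]; rewrite -qform_pick_scale.
have Hrf : schur_class (fun z => (r%:C)%C * f z).
  by apply: schur_class_scale => //; rewrite r0 ltW.
have fi0 : normc ((r%:C)%C * f (z i0)) < 1.
  rewrite normcM normc_real ger0_norm // (le_lt_trans _ r1) // ler_piMr //.
  exact: Hf.2.
have [g Hg gE] := schur_class_step Hrf (z1 i0) fi0.
have [|||||_] := @psd_on_pick_schur _ _ A z (fun i => (r%:C)%C * f (z i)) (g \o z) i0 Ai0.
- by move=> i; rewrite normr_lt1.
- by move=> i _; rewrite normr_le1 (Hrf.2 _ (z1 i)).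
- by rewrite normr_lt1.
- by move=> i /setD1P[ne Ai]; apply: contra_neq ne; apply: zI.
- by move=> i _; apply: gE.
apply; apply: IH => //; first by rewrite (cardsD1 i0) Ai0 in Am.
by move=> i j /setD1P[_ Ai] /setD1P[_ Aj]; apply: zI.
Qed.
End SchurClass.

(** * Power series *)

Section PowerSeries.
Variable R : realType.
Local Notation C := R[i].
Implicit Types (f g : C -> C) (a b : nat -> C) (c t z : C) (n m : nat).

Definition psum a n t : C := \sum_(m < n) a m * t ^+ m.

Definition sums_to a t (l : C) := forall e : R, 0 < e ->
  exists N : nat, forall n, (N <= n)%N -> normc (psum a n t - l) < e.

Definition pser a c f := exists2 d : R, 0 < d &
  forall t, normc t < d -> sums_to a t (f (c + t)).

Lemma psumS a n t : psum a n.+1 t = psum a n t + a n * t ^+ n.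
Proof. by rewrite /psum big_ord_recr. Qed.

(** In the topology of [Cplx R] radii are positive elements of the field itself, hence real complex
    numbers; this trades them for radii in [R]. *)
Lemma near_normcP (c : Cplx R) (P : Cplx R -> Prop) :
  (\forall z \near c, P z) <->
  exists2 d : R, 0 < d & forall t : C, normc t < d -> P (c + t).
Proof.
split=> [/nbhs_ballP[e /= e0 H]|[d d0 H]].
  have eE : e = ((complex.Re e)%:C)%C :> C.
    by apply/esym; apply: RRe_real; apply: gtr0_real e0.
  have r0 : 0 < complex.Re e by rewrite -ltcR -eE.
  exists (complex.Re e) => // t te; apply: H; rewrite -ball_normE /=.
  rewrite opprD addrA subrr sub0r normrN eE.
  by change ((normc t)%:C%C < ((complex.Re e)%:C)%C :> C); rewrite ltcR.
apply/nbhs_ballP; exists (d%:C)%C => /=; first by change (0 < (d%:C)%C :> C); rewrite ltcR.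
move=> z; rewrite -ball_normE /= distrC => zd.
have -> : z = c + (z - c) by rewrite addrC subrK.
apply: H; rewrite -ltcR; exact: zd.
Qed.

Lemma cvg_normcP (u : nat -> Cplx R) (l : Cplx R) :
  (u @ \oo --> l) <-> forall e : R, 0 < e ->
  exists N : nat, forall n, (N <= n)%N -> normc (u n - l : C) < e.
Proof.
split=> [/cvgrPdist_lt H e e0|H].
  have /H [N _ HN] : 0 < ((e%:C)%C : Cplx R) by change (0 < (e%:C)%C :> C); rewrite ltcR.
  exists N => n /HN; rewrite distrC => h; rewrite -ltcR; exact: h.
apply/cvgrPdist_lt => e e0.
have eE : e = ((complex.Re e)%:C)%C :> C.
  by apply/esym; apply: RRe_real; apply: gtr0_real e0.
have r0 : 0 < complex.Re e by rewrite -ltcR -eE.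
have [N HN] := H _ r0; exists N => // n /HN; rewrite -ltcR -eE => h.
rewrite distrC; exact: h.
Qed.

Lemma near_seriesP (a : nat -> Cplx R) (c : Cplx R) (f : Cplx R -> Cplx R) :
  (\forall z \near c, [series a m * (z - c) ^+ m]_m @ \oo --> f z) <-> pser a c f.
Proof.
have E t n : [series a m * (c + t - c) ^+ m]_m n = psum a n t.
  by rewrite /series /= big_mkord; apply: eq_bigr => i _; rewrite [c + t]addrC addrK.
split=> [/near_normcP [d d0 H]|[d d0 H]].
  exists d => // t /H /cvg_normcP Ht e /Ht [N HN]; exists N => n /HN.
  by rewrite E.
apply/near_normcP; exists d => // t /H Ht; apply/cvg_normcP => e /Ht [N HN].
by exists N => n /HN; rewrite E.
Qed.

Lemma analytic_onP (f : Cplx R -> Cplx R) :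
  analytic_on (@disk R) f <-> forall c : C, normc c < 1 -> exists a, pser a c f.
Proof.
split=> H c c1.
  have [|a Ha] := H c; first by rewrite /disk /= normr_lt1.
  by exists a; apply/near_seriesP.
have [|a Ha] := H c; first by rewrite -normr_lt1.
by exists a; apply/near_seriesP.
Qed.

(** At a real [t = r] inside the disk of convergence, each late term is a difference of two partial
    sums within 1 of the limit, so it is at most 2; the finitely many earlier ones are bounded by
    their sum. Then [s = 1 / r]. *)
Lemma pser_coef_bound a c f : pser a c f ->
  exists M s : R, [/\ 0 <= M, 0 < s & forall m, normc (a m) <= M * s ^+ m].
Proof.
move=> [d d0 H]; pose r := d / 2; have r0 : 0 < r by rewrite divr_gt0.
pose t : C := (r%:C)%C; have nt : normc t = r by rewrite normc_real gtr0_norm.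
have [|N HN] := H t _ 1 ltr01; first by rewrite nt /r; lra.
exists (2 + \sum_(m < N) normc (a m * t ^+ m)), r^-1.
have S0 : 0 <= \sum_(m < N) normc (a m * t ^+ m).
  by apply: sumr_ge0 => i _; apply: normc_ge0.
split=> [||m]; [by rewrite addr_ge0|by rewrite invr_gt0|].
rewrite exprVn ler_pdivlMr ?exprn_gt0 // -nt -normcX -normcM.
have [mN|Nm] := ltnP m N.
  rewrite (bigD1 (Ordinal mN)) //= addrCA lerDl addr_ge0 //.
  by apply: sumr_ge0 => i _; apply: normc_ge0.
have -> : a m * t ^+ m = (psum a m.+1 t - f (c + t)) - (psum a m t - f (c + t)).
  by rewrite psumS; ring.
rewrite (le_trans (le_normcB _ _)) //.
have := HN _ Nm; have := HN m.+1 (leq_trans Nm (leqnSn m)); lra.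
Qed.

Lemma geo_psum_bound (M x : R) a t N k : 0 <= M -> 0 <= x <= 1 / 2 ->
  (forall m, normc (a m * t ^+ m) <= M * x ^+ m) ->
  normc (psum a (N + k) t - psum a N t) <= 2 * M * x ^+ N.
Proof.
move=> M0 /andP[x0 x1] H.
have xN m : 0 <= x ^+ m by rewrite exprn_ge0.
(* The added tail makes the induction go through: it absorbs each new term because [x <= 1/2]. *)
suff : normc (psum a (N + k) t - psum a N t) + 2 * M * x ^+ (N + k) <= 2 * M * x ^+ N.
  by apply: le_trans; rewrite lerDl !mulr_ge0.
elim: k => [|k IH]; first by rewrite addn0 subrr normc0 add0r.
apply: le_trans IH; rewrite addnS psumS addrAC.
have := le_normcD (psum a (N + k) t - psum a N t) (a (N + k)%N * t ^+ (N + k)).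
have := H (N + k)%N; rewrite exprS.
have : M * (x * x ^+ (N + k)) <= M * (1 / 2 * x ^+ (N + k)).
  by rewrite ler_wpM2l // ler_wpM2r.
lra.
Qed.

Lemma pser_ordO a c f N : pser a c f ->
  ordO N (fun t => f (c + t) - psum a N t).
Proof.
move=> Hf; have [M [s [M0 s0 Hs]]] := pser_coef_bound Hf.
case: Hf => d d0 H; exists (2 * M * s ^+ N), (Num.min d (1 / (2 * s))); split.
- by rewrite !mulr_ge0 // exprn_ge0 // ltW.
- by rewrite lt_min d0 divr_gt0 // mulr_gt0.
move=> t; rewrite lt_min => /andP[td ts].
have x1 : s * normc t <= 1 / 2.
  by move: ts; rewrite ltr_pdivlMr ?mulr_gt0 //; lra.
(* The value of [f] is replaced by a far partial sum at cost [e], and the geometric bound applies to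
   the difference of two partial sums. *)
apply/ler_addgt0Pr => e e0; have [N' HN] := H t td e e0.
have h1 := HN (N + N')%N (leq_addl _ _).
have h2 : normc (psum a (N + N') t - psum a N t) <= 2 * M * (s * normc t) ^+ N.
  apply: geo_psum_bound => //; first by rewrite mulr_ge0 ?normc_ge0 // ltW.
  by move=> m; rewrite normcM normcX exprMn mulrA ler_wpM2r ?exprn_ge0 ?normc_ge0.
rewrite -mulrA -exprMn.
have -> : f (c + t) - psum a N t =
  (psum a (N + N') t - psum a N t) - (psum a (N + N') t - f (c + t)) by ring.
rewrite (le_trans (le_normcB _ _)) //; lra.
Qed.

Lemma psum_horner a n t : psum a n t = (\poly_(i < n) a i).[t].
Proof. by rewrite horner_poly. Qed.

Lemma pser_smooth a c f : pser a c f -> smooth f c.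
Proof.
move=> Hf n; exists (\poly_(i < n) a i); apply: eq_ordO (pser_ordO n Hf) => t.
by rewrite psum_horner.
Qed.

Lemma pser_at0 a c f : pser a c f -> f c = a 0%N.
Proof.
move=> /(pser_ordO 1) /ordO_at0 /eqP; rewrite addr0 subr_eq0 => /eqP ->.
by rewrite /psum big_ord1 expr0 mulr1.
Qed.

(** * Termwise differentiation of power series *)

Definition coef_deriv a m := a m.+1 *+ m.+1.

Lemma pser_ordO2 a c f : pser a c f ->
  ordO 2 (fun h => f (c + h) - (f c + a 1%N * h)).
Proof.
move=> Hf; apply: eq_ordO (pser_ordO 2 Hf) => h.
by rewrite (pser_at0 Hf) /psum !big_ord_recr big_ord0 /= expr0 expr1 mulr1 add0r.
Qed.

(** The error obeys [E (m+1) = (t + h) * E m + m * t^(m-1) * h^2], and [4 ^ m] is a generous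
    solution of the resulting recursion. Multiplying by [r ^ 2] avoids the exponent [m - 2]. *)
Lemma power_increment_bound (r : R) t h m : 0 < r -> normc t <= r -> normc (t + h) <= r ->
  normc ((t + h) ^+ m - t ^+ m - h * (t ^+ m.-1 *+ m)) * r ^+ 2
    <= 4 ^+ m * r ^+ m * normc h ^+ 2.
Proof.
move=> r0 tr thr; elim: m => [|m IH].
  by rewrite !expr0 subrr sub0r mulr0n mulr0 oppr0 normc0 mul0r !mul1r exprn_ge0 ?normc_ge0.
set E := _ - _ - _ in IH.
have -> : (t + h) ^+ m.+1 - t ^+ m.+1 - h * (t ^+ m.+1.-1 *+ m.+1) =
    (t + h) * E + t ^+ m.-1 *+ m * h ^+ 2.
  rewrite /E; case: m {IH E} => [|m] /=; first by rewrite !mulr0n !expr0; ring.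
  have -> : t ^+ m.+1 *+ m.+2 = t ^+ m.+1 + t * (t ^+ m *+ m.+1).
    by rewrite mulrS [in X in _ + X]exprS mulrnAr.
  by move: (t ^+ m *+ m.+1) => W; rewrite !(exprS (t + h)) !exprS; ring.
have rm : 0 <= r ^+ m by rewrite exprn_ge0 // ltW.
have E2 : normc (t ^+ m.-1 *+ m * h ^+ 2) * r ^+ 2 <= m%:R * r ^+ m.+1 * normc h ^+ 2.
  rewrite -[t ^+ m.-1 *+ m]mulr_natr !normcM !normcX (_ : normc (m%:R : C) = m%:R); last first.
    by rewrite -(rmorph_nat (real_complex R)) normc_real normr_nat.
  case: m {IH E rm} => [|m] /=; first by rewrite mulr0 !mul0r.
  have : normc t ^+ m <= r ^+ m by rewrite lerXn2r ?nnegrE ?normc_ge0 // ltW.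
  move=> h1; rewrite (exprS r m.+1) (exprS r m).
  rewrite [leRHS](_ : _ = r ^+ m * m.+1%:R * normc h ^+ 2 * r ^+ 2); last by ring.
  by rewrite -expr2 !ler_wpM2r ?exprn_ge0 ?normc_ge0 ?ler0n ?(ltW r0).
have E1 : normc ((t + h) * E) * r ^+ 2 <= r * (4 ^+ m * r ^+ m * normc h ^+ 2).
  by rewrite normcM -mulrA ler_pM ?normc_ge0 ?mulr_ge0 ?normc_ge0 ?exprn_ge0 ?(ltW r0).
have m4 : m%:R + 4 ^+ m <= 4 ^+ m.+1 :> R.
  rewrite -natrX -[X in _ <= X]natrX -natrD ler_nat.
  have : (m < 4 ^ m)%N by rewrite ltn_expl.
  rewrite expnS; lia.
rewrite (le_trans (ler_wpM2r _ (le_normcD _ _))) ?exprn_ge0 ?(ltW r0) // mulrDl.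
rewrite (le_trans (lerD E1 E2)) //.
rewrite [leLHS](_ : _ = (m%:R + 4 ^+ m) * (r ^+ m.+1 * normc h ^+ 2)); last first.
  by rewrite (exprS r); move: (4 ^+ m) (m%:R) => X Y; ring.
by rewrite -[leRHS]mulrA ler_wpM2r // mulr_ge0 ?exprn_ge0 ?normc_ge0 // ltW.
Qed.


Lemma psum_coef_deriv a n t :
  psum (coef_deriv a) n t = \sum_(m < n.+1) a m * (t ^+ m.-1 *+ m).
Proof.
rewrite big_ord_recl mulr0n mulr0 add0r; apply: eq_bigr => i _ /=.
by rewrite /coef_deriv mulrnAl mulrnAr.
Qed.

Lemma psum_increment a n t h :
  psum a n.+1 (t + h) - psum a n.+1 t - h * psum (coef_deriv a) n t =
  \sum_(m < n.+1) a m * ((t + h) ^+ m - t ^+ m - h * (t ^+ m.-1 *+ m)).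
Proof.
rewrite psum_coef_deriv mulr_sumr -!sumrB; apply: eq_bigr => i _.
by move: (t ^+ i.-1 *+ i) => W; ring.
Qed.

Lemma geo_sum_le2 n : \sum_(m < n) (1 / 2 : R) ^+ m <= 2.
Proof.
suff : \sum_(m < n) (1 / 2 : R) ^+ m + 2 * (1 / 2) ^+ n <= 2.
  by apply: le_trans; rewrite lerDl mulr_ge0 // exprn_ge0 //; lra.
elim: n => [|n IH]; first by rewrite big_ord0 add0r expr0 mulr1.
by apply: le_trans IH; rewrite big_ord_recr /= exprS; lra.
Qed.

(** The condition on [4 * s * r] dominates the terms by a geometric series of ratio 1/2, which makes
    the bound uniform in [n]. *)
Lemma psum_increment_bound a (M s r : R) n t h :
  0 <= M -> 0 < s -> 0 < r -> 4 * s * r <= 1 / 2 ->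
  (forall m, normc (a m) <= M * s ^+ m) ->
  normc t <= r -> normc (t + h) <= r ->
  normc (psum a n.+1 (t + h) - psum a n.+1 t - h * psum (coef_deriv a) n t)
    <= 2 * M / r ^+ 2 * normc h ^+ 2.
Proof.
move=> M0 s0 r0 sr Ha tr thr; rewrite psum_increment (le_trans (normc_sum _ _ _)) //.
have r20 : 0 < r ^+ 2 by rewrite exprn_gt0.
have h20 : 0 <= normc h ^+ 2 by rewrite exprn_ge0 ?normc_ge0.
apply: (@le_trans _ _ (\sum_(m < n.+1) M / r ^+ 2 * normc h ^+ 2 * (1 / 2) ^+ m)).
  apply: ler_sum => m _; rewrite normcM.
  have H := power_increment_bound m r0 tr thr.
  rewrite -ler_pdivlMr // in H.
  rewrite (le_trans (ler_pM (normc_ge0 _) (normc_ge0 _) (Ha m) H)) //.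
  rewrite [leLHS](_ : _ = M / r ^+ 2 * normc h ^+ 2 * (4 * s * r) ^+ m); last first.
    by rewrite !exprMn; field; rewrite gt_eqF.
  rewrite ler_wpM2l ?mulr_ge0 ?invr_ge0 ?(ltW r20) ?normc_ge0 //.
  by rewrite lerXn2r ?nnegrE ?mulr_ge0 ?(ltW s0) ?(ltW r0) //; lra.
rewrite -mulr_sumr [leRHS](_ : _ = M / r ^+ 2 * normc h ^+ 2 * 2); last by ring.
by rewrite ler_wpM2l ?geo_sum_le2 // !mulr_ge0 ?invr_ge0 ?(ltW r20) ?normc_ge0.
Qed.

(* The difference quotients of the partial sums are uniformly close to the
   partial sums of the derived series; since [f] is known to have derivative [g]
   near [c], this also yields convergence of the derived series, with no appeal to
   completeness. *)
Lemma pser_deriv a c f g (d0 : R) : 0 < d0 -> pser a c f ->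
  (forall t, normc t < d0 ->
     ordO 2 (fun h => f (c + t + h) - (f (c + t) + g (c + t) * h))) ->
  pser (coef_deriv a) c g.
Proof.
move=> d00 Hf Hg; have [M [s [M0 s0 Ha]]] := pser_coef_bound Hf.
case: Hf => d d_gt0 Hf; pose r := 1 / (8 * s).
have r0 : 0 < r by rewrite divr_gt0 // mulr_gt0.
have sr : 4 * s * r <= 1 / 2.
  by rewrite /r le_eqVlt; apply/orP; left; apply/eqP; field; rewrite gt_eqF.
exists (Num.min d (Num.min d0 r)); first by rewrite !lt_min d_gt0 d00.
move=> t; rewrite !lt_min => /and3P[td td0 tr] e e0.
have [K [d1 [K0 d10 HK]]] := Hg t td0.
pose K1 := 2 * M / r ^+ 2.
have K10 : 0 <= K1.
  by apply: divr_ge0; [exact: mulr_ge0|exact/exprn_ge0/ltW].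
(* Error budget for a real increment [x]: the two quadratic errors total at most [e * x / 2], and
   the partial sums at [t + h] and [t] contribute less than [e * x / 8] each, so the sum stays below
   [e * x]. *)
have [||x /andP[x0]] := exists_small (K := (K + K1) / (e / 2))
    (d := Num.min d1 (Num.min (r - normc t) (d - normc t))).
- by rewrite divr_ge0 ?addr_ge0 // divr_ge0 // ltW.
- by rewrite !lt_min d10 !subr_gt0 tr.
rewrite !lt_min mulrAC ltr_pdivrMr ?divr_gt0 // mul1r => /and3P[xd1 xr xd] xK.
pose h : C := (x%:C)%C; have nh : normc h = x by rewrite normc_real gtr0_norm.
have thx : normc (t + h) <= normc t + x by rewrite (le_trans (le_normcD _ _)) // nh.
have ex0 : 0 < e * x / 8 by rewrite divr_gt0 // mulr_gt0.
have [|N1 HN1] := Hf (t + h) _ _ ex0; first by apply: le_lt_trans thx _; lra.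
have [N2 HN2] := Hf t td _ ex0.
exists (maxn N1 N2) => n; rewrite geq_max => /andP[n1 n2].
have A1 := HN1 n.+1 (leq_trans n1 (leqnSn n)).
have A2 := HN2 n.+1 (leq_trans n2 (leqnSn n)).
have A3 := HK h; rewrite nh in A3; have {}A3 := A3 xd1.
have A4 := psum_increment_bound n M0 s0 r0 sr Ha (ltW tr) (_ : normc (t + h) <= r).
have {}A4 := A4 (le_trans thx _); rewrite nh -/K1 in A4.
have {}A4 : normc (psum a n.+1 (t + h) - psum a n.+1 t - h * psum (coef_deriv a) n t)
   <= K1 * x ^+ 2 by apply: A4; lra.
rewrite -(ltr_pM2r x0) -nh -normcM nh.
set p1 := psum a n.+1 (t + h) in A1 A4; set p2 := psum a n.+1 t in A2 A4.
set q := psum _ _ _ in A4 *.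
have -> : (q - g (c + t)) * h =
   (p1 - f (c + (t + h))) - (p2 - f (c + t)) - (p1 - p2 - h * q)
   + (f (c + t + h) - (f (c + t) + g (c + t) * h)) by rewrite (addrA c t h); ring.
rewrite (le_lt_trans (le_normcD _ _)) //.
have B1 := le_normcB (p1 - f (c + (t + h)) - (p2 - f (c + t))) (p1 - p2 - h * q).
have B2 := le_normcB (p1 - f (c + (t + h))) (p2 - f (c + t)).
have : (K + K1) * x ^+ 2 <= e / 2 * x by rewrite expr2 mulrA ler_wpM2r ?ltW.
lra.
Qed.

Lemma derive1C (f : Cplx R -> Cplx R) (c b : C) :
  ordO 2 (fun h => f (c + h) - (f c + b * h)) -> (f^`())%classic c = b.
Proof.
move=> [K [d [K0 d0 H]]]; rewrite /derive1; apply: cvg_lim => //.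
apply/cvgrPdist_lt => e e0.
have eE : e = ((complex.Re e)%:C)%C :> C.
  by apply/esym; apply: RRe_real; apply: gtr0_real e0.
have r0 : 0 < complex.Re e by rewrite -ltcR -eE.
have [||s /andP[s0 sd] sK] := exists_small (K := K / complex.Re e) (d := d) => //.
  by rewrite divr_ge0 // ltW.
rewrite mulrAC ltr_pdivrMr // mul1r in sK.
rewrite near_withinE; apply/near_normcP; exists s => // t ts t0.
rewrite add0r in t0 *; rewrite eE.
have t0' : t != 0 :> C := t0.
suff : normc (b - t^-1 * (f (t + c) - f c)) < complex.Re e.
  by rewrite -ltcR; exact: id.
have -> : b - t^-1 * (f (t + c) - f c) = - (t^-1 * (f (c + t) - (f c + b * t))).
  by rewrite [t + c]addrC; field.
rewrite normcN normcM normcV mulrC ltr_pdivrMr ?normc_gt0 //.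
rewrite (le_lt_trans (H t (lt_trans ts sd))) // expr2 mulrA ltr_pM2r ?normc_gt0 //.
by rewrite (le_lt_trans _ sK) // ler_wpM2l // ltW.
Qed.

(** The expansions of [f] at all points near [c] identify its derivative there, which is what
    [pser_deriv] asks for. *)
Lemma analytic_derive1 (f : Cplx R -> Cplx R) :
  analytic_on (@disk R) f -> analytic_on (@disk R) (f^`())%classic /\
  forall (c : C) a, normc c < 1 -> pser a c f -> pser (coef_deriv a) c (f^`())%classic.
Proof.
move=> /analytic_onP Hf.
have H (c : C) a : normc c < 1 -> pser a c f -> pser (coef_deriv a) c (f^`())%classic.
  move=> c1 Hac; have d0 : 0 < 1 - normc c by rewrite subr_gt0.
  apply: (pser_deriv d0 Hac) => t td.
  have [|b Hb] := Hf (c + t); first by rewrite (le_lt_trans (le_normcD _ _)) //; lra.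
  by have Ho := pser_ordO2 Hb; rewrite (derive1C Ho).
split=> //; apply/analytic_onP => c c1.
by have [a Ha] := Hf c c1; exists (coef_deriv a); apply: H.
Qed.

(** The multiplier is [(m + j)! / m!]; for vanishing only its positivity matters. *)
Lemma iter_coef_deriv a j m : exists2 k : nat, (0 < k)%N &
  iter j coef_deriv a m = a (m + j)%N *+ k.
Proof.
elim: j m => [|j IH] m; first by exists 1%N; rewrite ?addn0.
have [k k0 E] := IH m.+1; exists (k * m.+1)%N; first by rewrite muln_gt0 k0.
by rewrite iterS /coef_deriv E addSnnS mulrnA.
Qed.

Lemma derive1n_eq0 (f : Cplx R -> Cplx R) a j :
  analytic_on (@disk R) f -> pser a 0 f ->
  ((f^`(j))%classic 0 = 0) <-> a j = 0.
Proof.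
move=> Hf Ha.
have [_ /pser_at0 ->] : analytic_on (@disk R) (f^`(j))%classic /\
    pser (iter j coef_deriv a) 0 (f^`(j))%classic.
  elim: j => [|j [Hj Hja]]; first exact: (conj Hf Ha).
  rewrite derive1nS.
  have [Hd Hc] := analytic_derive1 Hj; split=> //.
  by apply: Hc; rewrite ?normc0.
have [k k0 ->] := iter_coef_deriv a j 0; rewrite add0n; split=> [/eqP|->].
  by rewrite mulrn_eq0 eqn0Ngt k0 => /eqP.
by rewrite mul0rn.
Qed.

(** Both sides say that the power series coefficients of [f] at 0 of indices 1 to [k] are zero. *)
Lemma derive1n_vanish (f : Cplx R -> Cplx R) k :
  analytic_on (@disk R) f ->
  (forall j, (1 <= j <= k)%N -> (f^`(j))%classic 0 = 0) <->
  ordO k.+1 (fun t => f t - f 0).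
Proof.
move=> Hf; have [a Ha] := (analytic_onP f).1 Hf 0 (eq_ind_r (fun x => x < 1) ltr01 (normc0 R)).
have O := pser_ordO k.+1 Ha; split=> [H|H j /andP[j1 jk]].
  apply: eq_ordO O => t; rewrite add0r; congr (_ - _).
  rewrite (pser_at0 Ha) /psum big_ord_recl expr0 mulr1 big1 ?addr0 // => i _.
  have -> : a (lift ord0 i) = 0; last by rewrite mul0r.
  by apply/(derive1n_eq0 _ Hf Ha); apply: H; rewrite lift0 ltn_ord.
apply/(derive1n_eq0 _ Hf Ha).
have Hp : ordO k.+1 (horner (\poly_(i < k.+1) a i - (a 0%N)%:P)).
  apply: eq_ordO (ordOD H (ordOZ (- 1) O)) => t.
  by rewrite hornerD hornerN hornerC -psum_horner (pser_at0 Ha) add0r; ring.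
have := ordO_coef Hp (jk : (j < k.+1)%N).
by rewrite coefB coef_poly coefC ltnS jk gtn_eqF // subr0.
Qed.

(** * Power series of rational functions *)

Lemma geo_lt (K e : R) : 0 <= K -> 0 < e ->
  exists N : nat, forall n, (N <= n)%N -> K * (1 / 2) ^+ n < e.
Proof.
move=> K0 e0; exists (Num.truncn (K / e)).+1 => n Nn.
have h1 : K / e < n%:R.
  by rewrite (lt_le_trans (truncnS_gt _)) // ler_nat.
have h2 : n%:R <= 2 ^+ n :> R by rewrite -natrX ler_nat ltnW // ltn_expl.
have h3 : 0 < (2 : R) ^+ n by rewrite exprn_gt0.
rewrite mul1r exprVn ltr_pdivrMr // mulrC -ltr_pdivrMr //; lra.
Qed.

Lemma pser_near a c f g :
  (exists2 d : R, 0 < d & forall t, normc t < d -> f (c + t) = g (c + t)) ->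
  pser a c f -> pser a c g.
Proof.
move=> [d d0 fg] [d' d'0 H]; exists (Num.min d d'); first by rewrite lt_min d0.
by move=> t; rewrite lt_min => /andP[td td']; rewrite -fg //; apply: H.
Qed.

Lemma pser_poly (p : {poly C}) c : pser (fun m => (p \Po ('X + c%:P))`_m) c (horner p).
Proof.
exists 1 => // t _ e e0; set q := p \Po _; exists (size q) => n qn.
have -> : psum (fun m => q`_m) n t = q.[t] by rewrite (horner_coef_wide _ qn).
by rewrite horner_comp !hornerE [t + c]addrC subrr normc0.
Qed.

(* Coefficients of the product of the series [a] with the geometric series
   of ratio [u t]. *)
Fixpoint coef_geo (u : C) a m : C :=
  if m is m'.+1 then u * coef_geo u a m' + a m'.+1 else a 0%N.

Lemma psum_coef_geo u a n t :
  (1 - u * t) * psum (coef_geo u a) n.+1 t =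
  psum a n.+1 t - u * coef_geo u a n * t ^+ n.+1.
Proof.
elim: n => [|n IH].
  by rewrite /psum !big_ord_recr !big_ord0 /= expr0 expr1; ring.
by rewrite psumS mulrDr IH [psum a n.+2 t]psumS (exprS t n.+1) /=; ring.
Qed.

(** With [u = (z0 - c)^-1], [1 / (z0 - c - t) = u / (1 - u t)], so the new coefficients are [u]
    times those of [coef_geo]. *)
Lemma pser_div_root a c f (z0 : C) : z0 != c -> pser a c f ->
  exists b, pser b c (fun z => f z / (z0 - z)).
Proof.
move=> zc Hf; pose v := z0 - c; have v0 : v != 0 by rewrite subr_eq0.
pose u := v^-1; have [M [s0 [M0 s00 Ha0]]] := pser_coef_bound Hf.
(* Taking [s >= 2 |u|] lets the bound [2 * M * s ^ m] survive the recursion for [coef_geo]. *)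
pose s := Num.max s0 (2 * normc u).
have s_gt0 : 0 < s by rewrite lt_max s00.
have su : normc u <= s / 2.
  have : 2 * normc u <= s by rewrite le_max lexx orbT.
  lra.
have Ha m : normc (a m) <= M * s ^+ m.
  apply: le_trans (Ha0 m) _; rewrite ler_wpM2l // lerXn2r ?nnegrE ?(ltW s00) ?(ltW s_gt0) //.
  by rewrite le_max lexx.
have Hb m : normc (coef_geo u a m) <= 2 * M * s ^+ m.
  elim: m => [|m IH]; first by have := Ha 0%N; rewrite !expr0 /=; lra.
  rewrite /= (le_trans (le_normcD _ _)) // normcM.
  have h1 : normc u * normc (coef_geo u a m) <= s / 2 * (2 * M * s ^+ m).
    by rewrite ler_pM ?normc_ge0.
  have := Ha m.+1; rewrite exprS; lra.
case: Hf => d d0 H; exists (fun m => u * coef_geo u a m).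
exists (Num.min d (1 / (2 * s))); first by rewrite lt_min d0 divr_gt0 // mulr_gt0.
move=> t; rewrite lt_min => /andP[td ts] e e0.
have x1 : s * normc t <= 1 / 2.
  by move: ts; rewrite ltr_pdivlMr ?mulr_gt0 //; lra.
have ut : normc (u * t) <= 1 / 2.
  have : normc u * normc t <= s / 2 * normc t by rewrite ler_wpM2r ?normc_ge0.
  by rewrite normcM; have := normc_ge0 t; lra.
have d1 : 1 / 2 <= normc (1 - u * t).
  by have := normc_sub_le 1 (u * t); rewrite normc1; lra.
have d1' : 1 - u * t != 0 by rewrite -normc_gt0; lra.
have vt : v - t != 0.
  have -> : v - t = v * (1 - u * t) by rewrite mulrBr mulrA mulfV // mul1r mulr1.
  by rewrite mulf_neq0.
have u_gt0 : 0 < normc u by rewrite normc_gt0 invr_eq0.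
(* Two errors below [e'] are multiplied by [|u / (1 - u t)| <= 2 |u|]. *)
pose e' := e / (4 * normc u); have e'0 : 0 < e' by rewrite divr_gt0 // mulr_gt0.
have [N1 HN1] := H t td e' e'0.
have [|N2 HN2] := @geo_lt (2 * M * normc (u * t)) e' _ e'0.
  by rewrite !mulr_ge0 ?normc_ge0.
exists (maxn N1 N2).+1 => -[//|n]; rewrite ltnS geq_max => /andP[n1 n2].
have A1 := HN1 n.+1 (leq_trans n1 (leqnSn n)); have A2 := HN2 n n2.
have A3 : normc (u * coef_geo u a n * t ^+ n.+1) <= 2 * M * normc (u * t) * (1 / 2) ^+ n.
  rewrite !normcM normcX exprS.
  have h : normc (coef_geo u a n) * normc t ^+ n <= 2 * M * (1 / 2) ^+ n.
    apply: le_trans (ler_wpM2r _ (Hb n)) _; first by rewrite exprn_ge0 ?normc_ge0.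
    rewrite -[leLHS]mulrA -exprMn ler_wpM2l ?mulr_ge0 //
      lerXn2r ?nnegrE ?mulr_ge0 ?normc_ge0 ?(ltW s_gt0) //.
  have := @ler_wpM2l _ (normc u * normc t) _ _ _ h.
  rewrite mulr_ge0 ?normc_ge0 // => /(_ isT); lra.
have -> : psum (fun m => u * coef_geo u a m) n.+1 t = u * psum (coef_geo u a) n.+1 t.
  by rewrite /psum mulr_sumr; apply: eq_bigr => i _; rewrite mulrA.
have -> : u * psum (coef_geo u a) n.+1 t - f (c + t) / (z0 - (c + t)) =
   u / (1 - u * t) * ((psum a n.+1 t - f (c + t)) - u * coef_geo u a n * t ^+ n.+1).
  have := psum_coef_geo u a n t => E.
  have -> : z0 - (c + t) = v - t by rewrite opprD addrA.
  have -> : psum a n.+1 t - f (c + t) - u * coef_geo u a n * t ^+ n.+1 =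
     (1 - u * t) * psum (coef_geo u a) n.+1 t - f (c + t) by rewrite E; ring.
  move: d1' ; rewrite /u => d1'; field.
  by rewrite vt v0.
rewrite normcM normcM (normcV (1 - u * t)).
have A4 := le_normcB (psum a n.+1 t - f (c + t)) (u * coef_geo u a n * t ^+ n.+1).
have A5 : (normc (1 - u * t))^-1 <= 2.
  by rewrite -[2]invrK lef_pV2 ?posrE; lra.
have ee : normc u * 2 * (2 * e') = e by rewrite /e'; field; rewrite gt_eqF.
rewrite -ee; apply: (@le_lt_trans _ _ (normc u * 2 *
  normc (psum a n.+1 t - f (c + t) - u * coef_geo u a n * t ^+ n.+1))).
  by rewrite ler_wpM2r ?normc_ge0 // ler_wpM2l ?normc_ge0.
rewrite ltr_pM2l ?mulr_gt0 //; lra.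
Qed.

Lemma pser_div_prod (s : seq C) a c f : c \notin s -> pser a c f ->
  exists b, pser b c (fun z => f z / \prod_(x <- s) (x - z)).
Proof.
elim: s a f => [|x s IH] a f.
  move=> _ Hf; exists a; apply: pser_near Hf; exists 1 => // t _.
  by rewrite big_nil divr1.
rewrite inE negb_or => /andP[cx cs] Hf.
have [|b Hb] := pser_div_root _ Hf (z0 := x); first by rewrite eq_sym.
have [b' Hb'] := IH _ _ cs Hb; exists b'; apply: pser_near Hb'; exists 1 => // t _.
by rewrite big_cons invfM mulrA.
Qed.

(** The field is algebraically closed, so [Q] splits and its roots can be divided out one at a time;
    writing factors as [x - z] costs a sign. *)
Lemma pser_rational (P Q : {poly C}) c : Q.[c] != 0 ->
  exists b, pser b c (fun z => P.[z] / Q.[z]).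
Proof.
move=> Qc; have [s Qs] := closed_field_poly_normal Q.
have QE z : Q.[z] = lead_coef Q * (-1) ^+ size s * \prod_(x <- s) (x - z).
  rewrite {1}Qs hornerZ horner_prod -mulrA; congr (_ * _).
  elim: s {Qs} => [|x s IH]; first by rewrite !big_nil mulr1.
  by rewrite !big_cons IH !hornerE /= exprS; ring.
have cs : c \notin s.
  apply: contraNN Qc => cs; rewrite QE; apply/eqP; apply/eqP.
  rewrite mulf_eq0; apply/orP; right; rewrite prodf_seq_eq0.
  by apply/hasP; exists c => //=; rewrite subrr.
have [b Hb] := pser_div_prod cs (pser_poly ((lead_coef Q * (-1) ^+ size s)^-1 *: P) c).
exists b; apply: pser_near Hb; exists 1 => // t _.
by rewrite QE hornerZ [in RHS]invfM mulrCA mulrA.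
Qed.

End PowerSeries.

(** * Interpolation with vanishing derivatives *)

Section Interpolation.
Variable R : realType.
Local Notation C := R[i].
Implicit Types (f : Cplx R -> Cplx R) (lambda : C) (P Q : {poly C}).

Lemma psdmx_psd_on n (K : 'I_n -> 'I_n -> Cplx R) :
  psdmx (\matrix_(i < n, j < n) K i j) <-> psd_on [set: 'I_n] (K : _ -> _ -> C).
Proof.
split=> H x.
  have := H (\col_i x i : 'cV[Cplx R]_n); congr (0 <= _).
  apply: eq_big => [i|i _]; first by rewrite inE.
  apply: eq_big => [j|j _]; first by rewrite inE.
  by rewrite !mxE.
have := H (fun i => x i 0); congr (0 <= _).
apply: eq_big => [i|i _]; first by rewrite inE.
apply: eq_big => [j|j _]; first by rewrite inE.
by rewrite !mxE.
Qed.

Lemma disk_normc (z : C) : @disk R z = (normc z < 1).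
Proof. by rewrite /disk /= -normr_lt1. Qed.

Lemma Hinf_schur_class f : Hinf f -> Hinf_norm f <= 1 -> schur_class (f : C -> C).
Proof.
move=> [fa [M HM]] f1; split=> z z1.
  by have [a Ha] := (analytic_onP f).1 fa z z1; apply: pser_smooth Ha.
apply: le_trans f1; apply: ub_le_sup; last by exists z => //; rewrite disk_normc.
by exists M => _ [y y1 <-]; apply: HM.
Qed.

(** Strict maximum principle, ensuring that [f 0] can serve as [lambda]. If [|f a| = 1], the
    two-point Pick matrix at [a], [b] has a zero diagonal entry, so [f a * (f b)^* = 1],
    contradicting [|f b| < 1]. *)
Lemma schur_class_lt1 (f : C -> C) (a b : C) :
  schur_class f -> normc a < 1 -> normc b < 1 -> normc (f b) < 1 -> normc (f a) < 1.
Proof.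
move=> Hf a1 b1 fb; have [->//|ab] := eqVneq a b.
rewrite lt_neqAle Hf.2 // andbT; apply/eqP => fa.
pose z (i : bool) := if i then a else b.
have z1 i : normc (z i) < 1 by case: i.
have zI : {in [set: bool]%SET &, injective z}.
  by move=> [] [] _ _ //= /eqP; rewrite ?(negbTE ab) // eq_sym (negbTE ab).
have Kp := pick_necessary z1 zI Hf.
have K0 : pick_kernel z (f \o z) true true = 0.
  have nfa : `|f a| = 1 by apply/eqP; rewrite eq_complex /= fa !eqxx.
  by rewrite /pick_kernel /= -normCK nfa expr1n subrr mul0r.
have := psd_on_diag0 (i := true) (j := false) Kp (fun i j _ _ => pick_kernelC _ _ _ _)
  (finset.in_setT _) (finset.in_setT _) K0.
move/eqP; rewrite mulf_eq0 invr_eq0 /= => /orP[]; apply/negP.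
  rewrite mulrC one_subM_neq0 ?norm_conjC ?normr_lt1 //.
  by rewrite normr_le1 fa.
by rewrite one_subM_neq0 ?norm_conjC ?normr_lt1 ?normr_le1 // ltW.
Qed.

Lemma schur_class_factor (f : C -> C) k : schur_class f -> normc (f 0) < 1 ->
  ordO k (fun t => f t - f 0) ->
  exists2 h, schur_class h &
    forall z, normc z < 1 -> phi (f 0) (f z) = z ^+ k * h z.
Proof.
move=> Hf f0 Of; apply: (schur_class_root0 (schur_class_mobius Hf f0)).
have n0 : normc (0 : C) < 1 by rewrite normc0.
have gs : smooth (fun z => 1 - (f 0)^* * f z) 0.
  apply: smoothB (smooth_cst _ _) _.
  by apply: smoothM (smooth_cst _ _) (Hf.1 0 n0).
have := ordOM Of (ordO0_inv (gs 1%N) (one_sub_conjM_neq0 f0 (ltW f0))).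
by rewrite addn0; apply: eq_ordO => t; rewrite add0r.
Qed.

Lemma psd_on_phi_necessary (I : finType) (z w : I -> C) f k :
  (forall i, normc (z i) < 1) -> injective z -> (forall i, f (z i) = w i) ->
  (forall i, normc (w i) < 1) ->
  Hinf_vanish [set j | (1 <= j <= k)%N] f -> Hinf_norm f <= 1 ->
  exists2 lambda : C, normc lambda < 1 &
  psd_on [set: I] (fun i j =>
    (z i ^+ k.+1 * (z j ^+ k.+1)^* - phi lambda (w i) * (phi lambda (w j))^*)
      / (1 - z i * (z j)^*)).
Proof.
move=> z1 zI fzw w1 [Hf Hd] f1.
have [i0|I0] := pickP I; last first.
  exists 0; first by rewrite normc0.
  by move=> x; rewrite /qform big1 // => i; have := I0 i.
move=> _.
have Sf := Hinf_schur_class Hf f1.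
have n0 : normc (0 : C) < 1 by rewrite normc0.
have f0 : normc (f 0) < 1 by apply: (schur_class_lt1 Sf n0 (z1 i0)); rewrite fzw.
exists (f 0) => //.
have Of := (derive1n_vanish k Hf.1).1 Hd.
have [h Hh hE] := schur_class_factor Sf f0 Of.
(* Congruence by [z ^ (k+1)] turns the Pick kernel of [h] into the required one, because
   [z ^ (k+1) * h] is [phi (f 0)] of [f]. *)
have := psd_on_congr (fun i => z i ^+ k.+1) (pick_necessary (A := [set: I]) z1 (in2W zI) Hh).
apply: eq_psd_on => i j _ _; rewrite -!fzw !hE // /pick_kernel /= !rmorphM /=.
ring.
Qed.

(** Here [f] is the inverse of [phi lambda] applied to [z ^ (k+1) * P / Q], with denominators
    cleared. *)
Lemma rational_interpolant_Hinf k lambda P Q : normc lambda < 1 ->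
  (forall z, normc z < 1 -> Q.[z] != 0 /\ normc P.[z] <= normc Q.[z]) ->
  let f : Cplx R -> Cplx R := fun z => ('X ^+ k.+1 * P + lambda *: Q).[z] /
                       (Q + lambda^* *: ('X ^+ k.+1 * P)).[z] in
  [/\ Hinf_vanish [set j | (1 <= j <= k)%N] f,  Hinf_norm f <= 1,
      f 0 = lambda &
      forall z v, normc z < 1 -> normc v <= 1 ->
        z ^+ k.+1 * P.[z] = phi lambda v * Q.[z] -> f z = v].
Proof.
move=> l1 PQ; set N := 'X ^+ k.+1 * P + _; set D := Q + _ => f.
have NE z : N.[z] = z ^+ k.+1 * P.[z] + lambda * Q.[z].
  by rewrite /N hornerD hornerZ hornerM hornerXn.
have DE z : D.[z] = Q.[z] + lambda^* * (z ^+ k.+1 * P.[z]).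
  by rewrite /D hornerD hornerZ hornerM hornerXn.
have ND z : normc z < 1 -> D.[z] != 0 /\ normc N.[z] <= normc D.[z].
  move=> z1; have [Qz PQz] := PQ z z1; rewrite NE DE -normr_le.
  apply: mobius_le => //; rewrite ?normr_lt1 // normr_le normcM normcX.
  by rewrite (le_trans _ PQz) // ler_piMl ?normc_ge0 // exprn_ile1 ?normc_ge0 // ltW.
have n0 : normc (0 : C) < 1 by rewrite normc0.
have f_le1 z : normc z < 1 -> normc (f z : C) <= 1.
  move=> z1; have [Dz NDz] := ND z z1.
  by rewrite /f normcM normcV ler_pdivrMr ?normc_gt0 // mul1r.
have fa : analytic_on (@disk R) f.
  apply/analytic_onP => c c1; apply: pser_rational; exact: (ND c c1).1.
have f0 : f 0 = lambda.
  by rewrite /f NE DE expr0n mul0r add0r mulr0 addr0 mulfK ?(PQ 0 n0).1.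
split=> //.
- split.
    by split=> //; exists 1 => z; rewrite disk_normc; apply: f_le1.
  apply/(derive1n_vanish k fa); rewrite f0.
  (* Indeed [f - lambda = (1 - |lambda|^2) * z ^ (k+1) * P / D]. *)
  have := ordOM (ordO_polyXn k.+1 ((1 - lambda * lambda^*) *: P))
    (ordO0_inv (smooth_poly D 0 1%N) (ND 0 n0).1).
  rewrite addn0; apply: ordO_near; exists 1 => // t t1.
  rewrite add0r /f; have := (ND t t1).1; rewrite NE !DE hornerZ => Dt.
  by field.
- apply: sup_le_ub.
    by exists (cmod (f 0)), 0 => //; rewrite disk_normc.
  by move=> _ [z z1 <-]; apply: f_le1; rewrite -disk_normc.
move=> z v z1 v1 E; have [Dz _] := ND z z1; apply: (mulIf Dz).
have lv := one_sub_conjM_neq0 l1 v1.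
rewrite /f divfK // NE DE E /phi.
by field.
Qed.

Lemma psd_on_phi_sufficient (I : finType) (z w : I -> C) lambda k :
  (forall i, normc (z i) < 1) -> injective z ->
  (forall i, normc (w i) < 1) -> normc lambda < 1 ->
  psd_on [set: I] (fun i j =>
    (z i ^+ k.+1 * (z j ^+ k.+1)^* - phi lambda (w i) * (phi lambda (w j))^*)
      / (1 - z i * (z j)^*)) ->
  exists f, [/\ Hinf_vanish [set j | (1 <= j <= k)%N] f,
         forall i, f (z i) = w i & Hinf_norm f <= 1].
Proof.
(* The data for [P / Q] are obtained by dividing by [z ^ (k+1)], so a node at 0 must be set
   aside. *)
move=> z1 zI w1 l1 Kp; pose A := [set i | z i != 0]%SET.
pose p i : C := phi lambda (w i); pose v i := p i / z i ^+ k.+1.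
have {}Kp : psd_on [set: I] (fun i j =>
  (z i ^+ k.+1 * (z j ^+ k.+1)^* - p i * (p j)^*) / (1 - z i * (z j)^*)) := Kp.
have Kv : psd_on A (pick_kernel z v).
  have := psd_on_congr (fun i => (z i ^+ k.+1)^-1) (psd_on_sub (finset.subsetT A) Kp).
  apply: eq_psd_on => i j; rewrite !inE => zi zj.
  rewrite /pick_kernel /v; move: (p i) (p j) => pi pj; rewrite rmorphM !fmorphV /=.
  field; rewrite !conjC_eq0 !expf_neq0 //=.
  by rewrite one_subM_neq0 ?norm_conjC ?normr_lt1 ?normr_le1 // ltW.
have [|P [Q [PQ PQv]]] := pick_interpolation (z := z) _ (in2W zI) Kv.
  by move=> i; rewrite normr_lt1.
have [|fH f1 f0 fE] := @rational_interpolant_Hinf k lambda P Q l1.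
  by move=> x; rewrite -normr_lt1 -normr_le; apply: PQ.
eexists; split; [exact: fH| |exact: f1] => i.
apply: fE => //; first exact: ltW.
have [zi|zi] := eqVneq (z i) 0; last first.
  by rewrite PQv ?inE // /v mulrA [_ * (_ / _)]mulrC divfK // expf_neq0.
(* At a node 0 the diagonal entry is [- |phi lambda (w i)|^2]; its nonnegativity forces
   [phi lambda (w i) = 0], which is what interpolation there requires. *)
have := psd_on_diag Kp (finset.in_setT i); rewrite zi expr0n /= conjC0 !mul0r subr0 sub0r divr1.
rewrite -normCK oppr_ge0 => /(conj (exprn_ge0 2 (normr_ge0 (p i)))) /andP.
rewrite -eq_le eq_sym expf_eq0 /= normr_eq0 => /eqP p0.
by rewrite -/(p i) p0 mul0r.
Qed.
End Interpolation.

Theorem theorem4p1 (R : realType) (k n : nat) (z w : 'I_n -> Cplx R)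
    (k_gt0 : (0 < k)%N) (z_inj : injective z)
    (z_disk : forall i, disk (z i)) (w_disk : forall i, disk (w i)) :
  (exists f : Cplx R -> Cplx R,
     [/\ Hinf_vanish [set j | (1 <= j <= k)%N] f,
         forall i, f (z i) = w i
       & Hinf_norm f <= 1])
  <->
  (exists lambda : Cplx R, disk lambda /\
     psdmx (\matrix_(i < n, j < n)
       ((z i ^+ k.+1 * (z j ^+ k.+1)^* - phi lambda (w i) * (phi lambda (w j))^*)
        / (1 - z i * (z j)^*)))).
Proof.
have z1 i : normc (z i) < 1 by rewrite -disk_normc.
have w1 i : normc (w i) < 1 by rewrite -disk_normc.
split=> [[f [fH fzw f1]]|[lambda [l1 Kp]]].
  have [lambda l1 Kp] := psd_on_phi_necessary z1 z_inj fzw w1 fH f1.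
  by exists lambda; rewrite disk_normc; split=> //; apply/psdmx_psd_on.
apply: (psd_on_phi_sufficient z1 z_inj w1 (lambda := lambda)).
  by rewrite -disk_normc.
exact/psdmx_psd_on.
Qed.
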